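(* Let $A$ be a separable $C^*$-algebra with $T(A)$ a Bauer simplex. Then $A$ has uniform property $\Gamma$ if and only if for each $n\in\mathbb N$, there exist projections $p_1,\dots,p_n\in A^\omega\cap A'$ summing to $1_{A^\omega}$ such that $$\tau(p_i)=\frac1n,\quad \tau\in T_\omega(A),\ i=1,\dots,n.$$
   Context: A trace on a $C^*$-algebra $A$ means a tracial state; $T(A)$ is the set of traces with the weak$^*$-topology. $T(A)$ is a Bauer simplex if $T(A)$ is compact and non-empty and its extreme boundary $\partial_eT(A)$ is compact. For non-empty $X\subseteq T(A)$, $\|a\|_{2,X}=\sup_{\tau\in X}\tau(a^*a)^{1/2}$. Fix a free ultrafilter $\omega$ on $\mathbb N$. When $T(A)\neq\emptyset$, the uniform tracial ultrapower is $A^\omega=\ell^\infty(A)/\{(a_n)_n:\lim_{n\to\omega}\|a_n\|_{2,T(A)}=0\}$. A limit trace is a trace on $A^\omega$ induced by $(a_n)_n\mapsto\lim_{n\to\omega}\tau_n(a_n)$ for some sequence $(\tau_n)_n$ in $T(A)$; $T_\omega(A)$ denotes the set of limit traces. There is a canonical map $\iota:A\to A^\omega$ by constant sequences (which need not be injective); $A^\omega\cap A'$ means $A^\omega\cap\iota(A)'$, and in products in $A^\omega$ an element $a\in A$ means $\iota(a)$. If $A$ is separable and $T(A)$ is compact and non-empty, then $A^\omega$ is unital. Uniform property $\Gamma$: a separable $C^*$-algebra $A$ with $T(A)$ non-empty and compact has uniform property $\Gamma$ if for all $n\in\mathbb N$ there exist projections $p_1,\dots,p_n\in A^\omega\cap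 A'$ summing to $1_{A^\omega}$ such that $\tau(ap_i)=\frac1n\tau(a)$ for all $a\in A$, $\tau\in T_\omega(A)$, $i=1,\dots,n$. *)

(* Defs.v *)
From HB Require Import structures.
From mathcomp Require Import all_boot all_order all_algebra.
From mathcomp Require Import complex ring lra.
From mathcomp Require Import all_classical all_reals all_analysis.

Set Implicit Arguments.
Unset Strict Implicit.
Unset Printing Implicit Defensive.

Import Order.TTheory GRing.Theory Num.Theory.
Import numFieldNormedType.Exports.
Local Open Scope classical_set_scope.
Local Open Scope quotient_scope.
Local Open Scope ring_scope.

(* The complex numbers.  The declared type [numClosedFieldType] is what makes
   the order (x <= y iff y - x is a nonnegative real), the norm topology and
   the conjugation of the libraries available on R[i]. *)
Definition Cplx (R : realType) : numClosedFieldType := R[i].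

(* The real part, as an element of R (and not of R[i] as with 'Re). *)
Definition re (R : realType) (z : Cplx R) : R := complex.Re z.

(* Algebras are not assumed to be unital. *)
HB.mixin Record Lmodule_isStarAlgebra (R : realType) A
    of GRing.Lmodule (Cplx R) A := {
  amul : A -> A -> A;
  star : A -> A;
  amulA : associative amul;
  amulDl : left_distributive amul +%R;
  amulDr : right_distributive amul +%R;
  amulZl : forall (c : Cplx R) (a b : A), amul (c *: a) b = c *: amul a b;
  amulZr : forall (c : Cplx R) (a b : A), amul a (c *: b) = c *: amul a b;
  starK : involutive star;
  starD : {morph star : a b / a + b};
  starZ : forall (c : Cplx R) (a : A), star (c *: a) = c^* *: star a;
  starM : forall a b : A, star (amul a b) = amul (star b) (star a)
}.

#[short(type="starAlgType")]
HB.structure Definition StarAlgebra (R : realType) :=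
  {A of GRing.Lmodule (Cplx R) A & Lmodule_isStarAlgebra R A}.

Reserved Notation "a ** b" (at level 40, left associativity).
Notation "a ** b" := (amul a b) : ring_scope.

HB.mixin Record StarAlgebra_isCStar (R : realType) A
    of CompleteNormedModule (Cplx R) A & StarAlgebra R A := {
  cnormM : forall a b : A, `|a ** b| <= `|a| * `|b|;
  cnorm_star : forall a : A, `|star a ** a| = `|a| ^+ 2
}.

#[short(type="cstarType")]
HB.structure Definition CStar (R : realType) :=
  {A of CompleteNormedModule (Cplx R) A & StarAlgebra R A
      & StarAlgebra_isCStar R A}.

Section traces.
Context {R : realType} (A : cstarType R).
Local Notation C := (Cplx R).

Definition separable_space := exists2 D : set A, countable D & dense D.

Definition functional_norm (f : A -> C) : \bar R :=
  ereal_sup [set (re `|f a|)%:E | a in [set a : A | `|a| <= 1]].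

Definition is_state (f : A -> C) :=
  [/\ scalar f, forall a : A, 0 <= f (star a ** a) & functional_norm f = 1%E].

Definition is_trace (f : A -> C) :=
  is_state f /\ forall a b : A, f (a ** b) = f (b ** a).

(* The weak* topology is the topology of pointwise convergence. *)
Definition traces : set {ptws A -> C} := [set f | is_trace f].

Definition extreme_points (X : set {ptws A -> C}) : set {ptws A -> C} :=
  [set f | X f /\ forall (g h : A -> C) (t : C), X g -> X h -> 0 < t < 1 ->
    (f : A -> C) = (fun a => t * g a + (1 - t) * h a) -> g = f /\ h = f].

Definition bauer_traces :=
  [/\ compact traces, traces !=set0 & compact (extreme_points traces)].

(* For a trace f, f (a^* a) <= |a|^2 (see [tr_sq_norm]), so that the supremum is
   over a bounded set as soon as X consists of traces. *)
Definition norm2 (X : set {ptws A -> C}) (a : A) : R :=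
  sup [set Num.sqrt (re (f (star a ** a))) | f in X].

End traces.
Arguments traces {R} A _.

Section star_algebra_elements.
Context {R : realType} (A : starAlgType R).

Definition is_projection (p : A) := star p = p /\ p ** p = p.

Definition is_unit_element (e : A) := forall x : A, e ** x = x /\ x ** e = x.

Definition commutant (B : set A) : set A :=
  [set x | forall b, B b -> x ** b = b ** x].

End star_algebra_elements.


Section norm_star.
Context {R : realType} (A : cstarType R).

Lemma amul0r (a : A) : 0 ** a = 0.
Proof. by rewrite -[0 in LHS](scale0r (0 : A)) amulZl scale0r. Qed.

Lemma star0 : star (0 : A) = 0.
Proof. by rewrite -[0 in LHS](scale0r (0 : A)) starZ rmorph0 scale0r. Qed.

Lemma le_norm_star (a : A) : `|a| <= `|star a|.
Proof.
have [->|a0] := eqVneq a 0; first by rewrite normr0.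
have na : 0 < `|a| by rewrite normr_gt0.
by rewrite -(ler_pM2r na) -expr2 -cnorm_star cnormM.
Qed.

Lemma norm_star (a : A) : `|star a| = `|a|.
Proof.
by apply/eqP; rewrite eq_le le_norm_star -{2}(starK a) le_norm_star.
Qed.

End norm_star.

(* The bounded sequences in A, with pointwise operations. *)
Section bounded_sequences.
Context {R : realType} {A : cstarType R}.
Local Notation C := (Cplx R).

Definition bounded_seq : {pred nat -> A} :=
  [pred a | `[< exists M : C, forall n, `|a n| <= M >]].

Lemma bounded_seqP (a : nat -> A) :
  reflect (exists M : C, forall n, `|a n| <= M) (a \in bounded_seq).
Proof. exact: asboolP. Qed.

Lemma bounded_seq_submod : submod_closed bounded_seq.
Proof.
split; first by apply/bounded_seqP; exists 0 => n; rewrite normr0.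
move=> c a b /bounded_seqP[M aM] /bounded_seqP[N bN]; apply/bounded_seqP.
exists (`|c| * M + N) => n.
by rewrite (le_trans (ler_normD _ _))// normrZ lerD// ler_wpM2l.
Qed.

HB.instance Definition _ :=
  GRing.isSubmodClosed.Build C (nat -> A) bounded_seq bounded_seq_submod.

End bounded_sequences.

Section linfty.
Context {R : realType} (A : cstarType R).
Local Notation C := (Cplx R).

Record linfty := Linfty {
  seq_of :> nat -> A;
  seq_ofP : seq_of \in bounded_seq
}.

HB.instance Definition _ := [isSub for seq_of].
HB.instance Definition _ := [Choice of linfty by <:].
HB.instance Definition _ := [SubChoice_isSubLmodule of linfty by <:].

Lemma linfty_bound (a : linfty) :
  exists2 M : C, 0 < M & forall n, `|a n| <= M.
Proof.
have /bounded_seqP[M aM] := seq_ofP a.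
have M0 : 0 <= M by rewrite (le_trans _ (aM 0%N)).
exists (M + 1) => [|n]; first by rewrite ltr_wpDl.
by rewrite (le_trans (aM n))// lerDl.
Qed.

Lemma linfty_eq (a b : linfty) : (forall n, a n = b n) -> a = b.
Proof. by move=> ab; apply/val_inj/funext. Qed.

Lemma amul_bounded (a b : linfty) :
  (fun n => a n ** b n) \in (bounded_seq : {pred nat -> A}).
Proof.
have [M _ aM] := linfty_bound a; have [N _ bN] := linfty_bound b.
apply/bounded_seqP; exists (M * N) => n.
by rewrite (le_trans (cnormM _ _))// ler_pM.
Qed.

Lemma star_bounded (a : linfty) :
  (fun n => star (a n)) \in (bounded_seq : {pred nat -> A}).
Proof.
have [M _ aM] := linfty_bound a.
by apply/bounded_seqP; exists M => n; rewrite norm_star.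
Qed.

Lemma cst_bounded (a : A) :
  (fun=> a) \in (bounded_seq : {pred nat -> A}).
Proof. by apply/bounded_seqP; exists `|a|. Qed.

Definition linfty_mul (a b : linfty) := Linfty (amul_bounded a b).
Definition linfty_star (a : linfty) := Linfty (star_bounded a).
Definition linfty_cst (a : A) := Linfty (cst_bounded a).

Lemma linfty_mulA : associative linfty_mul.
Proof. by move=> a b c; apply: linfty_eq => n; rewrite /= amulA. Qed.

Lemma linfty_mulDl : left_distributive linfty_mul +%R.
Proof. by move=> a b c; apply: linfty_eq => n; rewrite /= amulDl. Qed.

Lemma linfty_mulDr : right_distributive linfty_mul +%R.
Proof. by move=> a b c; apply: linfty_eq => n; rewrite /= amulDr. Qed.

Lemma linfty_mulZl (c : C) (a b : linfty) :
  linfty_mul (c *: a) b = c *: linfty_mul a b.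
Proof. by apply: linfty_eq => n; rewrite /= amulZl. Qed.

Lemma linfty_mulZr (c : C) (a b : linfty) :
  linfty_mul a (c *: b) = c *: linfty_mul a b.
Proof. by apply: linfty_eq => n; rewrite /= amulZr. Qed.

Lemma linfty_starK : involutive linfty_star.
Proof. by move=> a; apply: linfty_eq => n; rewrite /= starK. Qed.

Lemma linfty_starD : {morph linfty_star : a b / a + b}.
Proof. by move=> a b; apply: linfty_eq => n; rewrite /= starD. Qed.

Lemma linfty_starZ (c : C) (a : linfty) :
  linfty_star (c *: a) = c^* *: linfty_star a.
Proof. by apply: linfty_eq => n; rewrite /= starZ. Qed.

Lemma linfty_starM (a b : linfty) :
  linfty_star (linfty_mul a b) = linfty_mul (linfty_star b) (linfty_star a).
Proof. by apply: linfty_eq => n; rewrite /= starM. Qed.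

HB.instance Definition _ := Lmodule_isStarAlgebra.Build R linfty
  linfty_mulA linfty_mulDl linfty_mulDr linfty_mulZl linfty_mulZr
  linfty_starK linfty_starD linfty_starZ linfty_starM.

End linfty.
Section trace_seminorm.
Context {R : realType} {A : cstarType R}.
Local Notation C := (Cplx R).

Lemma re_le (x y : C) : x <= y -> re x <= re y.
Proof. by case: x y => [a b] [c d] /andP[]. Qed.

Lemma reD (x y : C) : re (x + y) = re x + re y.
Proof. by case: x y => [a b] [c d]. Qed.

Lemma reN (x : C) : re (- x) = - re x.
Proof. by case: x. Qed.

Lemma re_ge0 (x : C) : 0 <= x -> 0 <= re x.
Proof. exact: re_le. Qed.

Lemma reK (x : C) : 0 <= x -> (re x)%:C%C = x.
Proof. by case: x => [a b] /andP[/eqP/= -> _]. Qed.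

Lemma real_le (r s : R) : (r%:C%C <= s%:C%C :> C) = (r <= s).
Proof. exact: lecR. Qed.

Variables (f : A -> C) (tf : is_trace f).

Lemma tr_scalar : scalar f. Proof. by case: tf => -[]. Qed.

Lemma trD a b : f (a + b) = f a + f b.
Proof. by have := tr_scalar 1 a b; rewrite scale1r mul1r. Qed.

Lemma tr0 : f 0 = 0.
Proof. by apply: (addrI (f 0)); rewrite -trD !addr0. Qed.

Lemma trZ c a : f (c *: a) = c * f a.
Proof. by have := tr_scalar c a 0; rewrite tr0 !addr0. Qed.

Lemma tr_ge0 a : 0 <= f (star a ** a).
Proof. by case: tf => -[]. Qed.

Lemma trC a b : f (a ** b) = f (b ** a).
Proof. by case: tf. Qed.

Lemma tr_norm a : `|f a| <= `|a|.
Proof.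
have [->|a0] := eqVneq a 0; first by rewrite tr0 !normr0.
have na : 0 < `|a| by rewrite normr_gt0.
case: tf => -[_ _ f1] _.
suff : `|f (`|a|^-1 *: a)| <= 1.
  by rewrite trZ normrM normfV normr_id ler_pdivrMl// mulr1.
rewrite -(reK (normr_ge0 (f _))) -(@reK 1 ler01) real_le -lee_fin.
have -> : (re (1 : C))%:E = 1%E :> \bar R by [].
rewrite -[leRHS]f1; apply: ereal_sup_ubound; exists (`|a|^-1 *: a) => //=.
by rewrite normrZ normfV normr_id mulVf// gt_eqF.
Qed.

Lemma tr_expand (c : C) x y : c^* = c ->
  f (star (x + c *: y) ** (x + c *: y)) =
  f (star x ** x) + c * (f (star x ** y) + f (star y ** x))
  + c ^+ 2 * f (star y ** y).
Proof.
move=> cc.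
rewrite starD starZ cc !(amulDl, amulDr, amulZl, amulZr) !(trD, trZ).
by ring.
Qed.

Lemma tr_subE x y :
  f (star (x - y) ** (x - y)) =
  f (star x ** x) - (f (star x ** y) + f (star y ** x)) + f (star y ** y).
Proof.
rewrite -scaleN1r tr_expand; first by rewrite sqrrN expr1n; ring.
by rewrite rmorphN1.
Qed.

Lemma tr_parallelogram x y :
  f (star (x - y) ** (x - y)) + f (star (x + y) ** (x + y)) =
  2 * (f (star x ** x) + f (star y ** y)).
Proof.
have := @tr_expand 1 x y (rmorph1 _); rewrite scale1r => ->.
by rewrite tr_subE expr1n; ring.
Qed.

Lemma tr_sq_sub x y : f (star (x - y) ** (x - y)) <=
  2 * (f (star x ** x) + f (star y ** y)).
Proof. by rewrite -tr_parallelogram lerDl tr_ge0. Qed.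

Lemma tr_sqZ c x :
  f (star (c *: x) ** (c *: x)) = `|c| ^+ 2 * f (star x ** x).
Proof. by rewrite starZ amulZl amulZr !trZ mulrA [c^* * c]mulrC -normCK. Qed.

Lemma tr_sq_norm x : f (star x ** x) <= `|x| ^+ 2.
Proof. by rewrite -cnorm_star -[leLHS]ger0_norm ?tr_ge0// tr_norm. Qed.

(* This replaces the usual appeal to a^*a <= |a|^2 in the unitization: the
   supremum M of f(b^*a^*ab) over the unit ball satisfies 2M <= f(b^*b) + M,
   by positivity at b - a^*ab. *)
Lemma tr_sqM_unit a b : `|a| <= 1 ->
  f (star (a ** b) ** (a ** b)) <= f (star b ** b).
Proof.
pose q x : R := re (f (star x ** x)).
pose S := [set q (x ** b) | x in [set x : A | `|x| <= 1]].
have S0 : S !=set0 by exists (q (0 ** b)); exists 0 => //=; rewrite normr0.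
have ubS : ubound S (re (`|b| ^+ 2 : C)).
  move=> _ [x /= x1 <-]; apply: re_le; rewrite (le_trans (tr_sq_norm _))//.
  rewrite lerXn2r ?nnegrE// (le_trans (cnormM _ _))//.
  by rewrite ler_piMl.
have supS : has_sup S by split=> //; exists (re (`|b| ^+ 2 : C)).
have key : sup S <= q b.
  suff : sup S <= 2^-1 * (q b + sup S).
    by rewrite ler_pdivlMl// mulrDl mul1r lerD2r.
  apply: ge_sup => // _ [x /= x1 <-].
  rewrite ler_pdivlMl// -subr_ge0.
  have x1' : `|star x ** x| <= 1 by rewrite cnorm_star expr_le1.
  have : q (star x ** x ** b) <= sup S.
    by apply: sup_upper_bound => //; exists (star x ** x).
  have := re_ge0 (tr_ge0 (b - star x ** x ** b)).
  have e1 : star b ** (star x ** x ** b) = star (x ** b) ** (x ** b).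
    by rewrite starM !amulA.
  have e2 : star (star x ** x ** b) ** b = star (x ** b) ** (x ** b).
    by rewrite !starM starK !amulA.
  rewrite tr_subE e1 e2 /q !(reD, reN); move: (re _) (re _) (re _) => r s t.
  by lra.
move=> a1; rewrite -(reK (tr_ge0 _)) -[leRHS](reK (tr_ge0 _)) real_le.
apply: le_trans key; apply: sup_upper_bound => //; by exists a.
Qed.

Lemma tr_sqM (M : C) a b : 0 < M -> `|a| <= M ->
  f (star (a ** b) ** (a ** b)) <= M ^+ 2 * f (star b ** b).
Proof.
move=> M0 aM.
have -> : a ** b = M *: ((M^-1 *: a) ** b).
  by rewrite amulZl scalerA mulfV ?scale1r// gt_eqF.
rewrite tr_sqZ gtr0_norm// ler_pM2l ?exprn_gt0//.
apply: tr_sqM_unit.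
by rewrite normrZ normfV gtr0_norm// ler_pdivrMl// mulr1.
Qed.

Lemma tr_sq_star a : f (star (star a) ** star a) = f (star a ** a).
Proof. by rewrite starK trC. Qed.

End trace_seminorm.

(* An ultrafilter on nat is free iff it contains no singleton. *)
Record free_ultrafilter := FreeUltrafilter {
  fu_filter :> set_system nat;
  fu_ultra : UltraFilter fu_filter;
  fu_free : forall n, ~ fu_filter [set n]
}.
#[global] Existing Instance fu_ultra.

Section null_sequences.
Context {R : realType} {A : cstarType R} (omega : free_ultrafilter).
Local Notation C := (Cplx R).
Local Notation unorm := (norm2 (traces A)).

Definition null_seq : {pred linfty A} :=
  [pred a : linfty A | `[< (fun n => unorm (a n)) @ fu_filter omega --> (0 : R) >]].

Lemma null_seqP (a : linfty A) :
  reflect ((fun n => unorm (a n)) @ fu_filter omega --> (0 : R)) (a \in null_seq).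
Proof. exact: asboolP. Qed.

Lemma norm2_le (a : A) (c : R) : 0 <= c ->
  (forall f : A -> C, is_trace f -> re (f (star a ** a)) <= c ^+ 2) ->
  unorm a <= c.
Proof.
move=> c0 ac; rewrite /norm2; set S := [set _ | _ in _].
have [->|/set0P S0] := eqVneq S set0; first by rewrite sup0.
apply: ge_sup => // _ [f tf <-].
by rewrite (le_trans (ler_wsqrtr (ac f tf)))// sqrtr_sqr ger0_norm.
Qed.

Lemma norm2_ubound (f : A -> C) (a : A) : is_trace f ->
  Num.sqrt (re (f (star a ** a))) <= unorm a.
Proof.
move=> tf; apply: sup_upper_bound; last by exists f.
split; first by exists (Num.sqrt (re (f (star a ** a)))); exists f.
exists (Num.sqrt (re (`|a| ^+ 2 : C))) => _ [g tg <-].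
by rewrite ler_wsqrtr// re_le// tr_sq_norm.
Qed.

Lemma norm2_ge0 (a : A) : 0 <= unorm a.
Proof.
have [[f tf]|tr0] := pselect (exists f : A -> C, is_trace f).
  by rewrite (le_trans _ (norm2_ubound a tf)).
rewrite /norm2; set S := [set _ | _ in _].
suff -> : S = set0 by rewrite sup0.
by rewrite -subset0 => x [f tf _]; apply: tr0; exists f.
Qed.

Lemma norm2_ge (f : A -> C) (a : A) : is_trace f ->
  re (f (star a ** a)) <= unorm a ^+ 2.
Proof.
move=> tf; rewrite -[leLHS]sqr_sqrtr ?re_ge0 ?tr_ge0//.
by rewrite lerXn2r ?nnegrE ?sqrtr_ge0 ?norm2_ge0// norm2_ubound.
Qed.

Lemma norm2_sub (a b : A) : unorm (a - b) <= 2 * (unorm a + unorm b).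
Proof.
apply: norm2_le => [|f tf]; first by rewrite mulr_ge0// addr_ge0// norm2_ge0.
apply: (le_trans (re_le (tr_sq_sub tf a b))).
have := norm2_ge a tf; have := norm2_ge b tf.
have := norm2_ge0 a; have := norm2_ge0 b.
rewrite mulr_natl mulr2n !reD; move: (unorm a) (unorm b) (re _) (re _).
by move=> x y p q *; nra.
Qed.

Lemma norm2M (M : R) (a b : A) : 0 < M -> `|a| <= M%:C%C ->
  unorm (a ** b) <= M * unorm b.
Proof.
move=> M0 aM.
apply: norm2_le => [|f tf]; first by rewrite mulr_ge0 ?norm2_ge0// ltW.
have M0' : 0 < M%:C%C :> C by rewrite ltcR.
apply: (le_trans (re_le (tr_sqM tf b M0' aM))).
have reM (z : C) : re ((M%:C%C : C) ^+ 2 * z) = M ^+ 2 * re z.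
  by case: z => x y; rewrite -rmorphXn /= !mul0r subr0.
by rewrite reM exprMn ler_wpM2l ?sqr_ge0// norm2_ge.
Qed.

Lemma norm2_star (a : A) : unorm (star a) = unorm a.
Proof.
rewrite /norm2; congr sup; apply: eq_imagel => f tf.
by rewrite (tr_sq_star tf).
Qed.

Lemma null_seq_dom (K : R) (a b c : linfty A) :
  (forall n, unorm (c n) <= K * (unorm (a n) + unorm (b n))) ->
  a \in null_seq -> b \in null_seq -> c \in null_seq.
Proof.
move=> cab /null_seqP a0 /null_seqP b0; apply/null_seqP.
apply: (@squeeze_cvgr _ _ _ _ (fun=> 0)
  (fun n => K * (unorm (a n) + unorm (b n)))).
- by apply: nearW => n; rewrite norm2_ge0 cab.
- exact: cvg_cst.
- rewrite -(mulr0 K) -(addr0 0); apply: cvgM; first exact: cvg_cst.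
  exact: cvgD.
Qed.

Lemma norm2_0 : unorm 0 = 0.
Proof.
apply/eqP; rewrite eq_le norm2_ge0 andbT.
by apply: norm2_le => // f tf; rewrite star0 amul0r (tr0 tf) expr0n.
Qed.

Lemma null_seq0 : 0 \in null_seq.
Proof.
apply/null_seqP; suff -> : (fun n => unorm ((0 : linfty A) n)) = fun=> 0.
  exact: cvg_cst.
by apply/funext => n; exact: norm2_0.
Qed.

Lemma null_seq_zmod : zmod_closed null_seq.
Proof.
split; first exact: null_seq0.
by move=> a b; apply: (@null_seq_dom 2) => n; exact: norm2_sub.
Qed.

HB.instance Definition _ :=
  GRing.isZmodClosed.Build (linfty A) null_seq null_seq_zmod.

Lemma null_seqMr (a b : linfty A) : b \in null_seq -> a ** b \in null_seq.
Proof.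
move=> b0; have [M M0 aM] := linfty_bound a.
apply: (@null_seq_dom (re M) b b) => // n.
have eM : (re M)%:C%C = M by rewrite reK// ltW.
have reM0 : 0 < re M by rewrite -ltcR eM.
rewrite (le_trans (@norm2M (re M) _ _ _ _)) ?eM//.
by rewrite ler_wpM2l ?(ltW reM0)// lerDl norm2_ge0.
Qed.

Lemma null_seq_star (a : linfty A) : a \in null_seq -> star a \in null_seq.
Proof.
move=> a0; apply: (@null_seq_dom 1 a a) => // n.
by rewrite norm2_star mul1r lerDl norm2_ge0.
Qed.

Lemma null_seqMl (a b : linfty A) : a \in null_seq -> a ** b \in null_seq.
Proof.
move=> a0; rewrite -(starK (a ** b)) starM.
by apply/null_seq_star/null_seqMr/null_seq_star.
Qed.

Lemma null_seqZ (c : C) (a : linfty A) :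
  a \in null_seq -> c *: a \in null_seq.
Proof.
move=> a0; apply: (@null_seq_dom (re `|c|) a a) => // n.
have c0 : 0 <= re `|c| by exact: re_ge0.
apply: norm2_le => [|f tf].
  by rewrite mulr_ge0// addr_ge0// norm2_ge0.
have reM (r : R) (z : C) : re ((r%:C%C : C) ^+ 2 * z) = r ^+ 2 * re z.
  by case: z => x y; rewrite -rmorphXn /= !mul0r subr0.
rewrite (_ : (c *: a : linfty A) n = c *: a n)// (tr_sqZ tf).
rewrite -[in `|c|](reK (normr_ge0 c)) reM exprMn ler_wpM2l ?sqr_ge0//.
rewrite (le_trans (norm2_ge _ tf))// lerXn2r ?nnegrE ?norm2_ge0 ?addr_ge0//.
- exact: norm2_ge0.
- exact: norm2_ge0.
- by rewrite lerDl norm2_ge0.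
Qed.

End null_sequences.

Section uniform_tracial_ultrapower.
Context {R : realType} (omega : free_ultrafilter) (A : cstarType R).
Local Notation C := (Cplx R).

Definition ultrapower : Type := Quotient.quot (@null_seq R A omega).

HB.instance Definition _ := GRing.Zmodule.on ultrapower.

Definition uclass (a : linfty A) : ultrapower :=
  \pi_(Quotient.quot (@null_seq R A omega)) a.

Definition urepr (x : ultrapower) : linfty A :=
  repr (x : (Quotient.quot (@null_seq R A omega))).

Lemma ureprK : cancel urepr uclass.
Proof. by move=> x; rewrite /uclass /urepr reprK. Qed.

Lemma uclass_eq (a b : linfty A) :
  uclass a = uclass b <-> a - b \in null_seq omega.
Proof.
split=> [/eqP|ab]; first by rewrite /uclass eqmodE.
by apply/eqP; rewrite /uclass eqmodE.
Qed.

Lemma uclassD (a b : linfty A) : uclass (a + b) = uclass a + uclass b.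
Proof. by rewrite /uclass raddfD. Qed.

Lemma urepr_uclass (a : linfty A) : urepr (uclass a) - a \in null_seq omega.
Proof. by apply/uclass_eq; rewrite ureprK. Qed.

(* The operations are defined on representatives; [uscaleE], [umulE] and
   [ustarE] show that they do not depend on them. *)
Definition uscale (c : C) (x : ultrapower) : ultrapower := uclass (c *: urepr x).
Definition umul (x y : ultrapower) : ultrapower := uclass (urepr x ** urepr y).
Definition ustar (x : ultrapower) : ultrapower := uclass (star (urepr x)).

Lemma amulN (a b : linfty A) : a ** (- b) = - (a ** b).
Proof. by rewrite -scaleN1r amulZr scaleN1r. Qed.

Lemma amulNl (a b : linfty A) : (- a) ** b = - (a ** b).
Proof. by rewrite -scaleN1r amulZl scaleN1r. Qed.

Lemma uscaleE c a : uscale c (uclass a) = uclass (c *: a).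
Proof.
by apply/uclass_eq; rewrite -scalerBr; apply/null_seqZ/urepr_uclass.
Qed.

Lemma umulE a b : umul (uclass a) (uclass b) = uclass (a ** b).
Proof.
apply/uclass_eq; set a' := urepr _; set b' := urepr _.
have -> : a' ** b' - a ** b = (a' - a) ** b' + a ** (b' - b).
  by rewrite amulDl amulDr amulN amulNl addrA subrK.
by apply: rpredD; [apply: null_seqMl|apply: null_seqMr]; exact: urepr_uclass.
Qed.

Lemma ustarE a : ustar (uclass a) = uclass (star a).
Proof.
apply/uclass_eq; rewrite -[- star a]scaleN1r.
rewrite -[-1 in X in X *: _](@rmorphN1 _ _ (@Num.conj C)).
by rewrite -starZ -starD scaleN1r; apply/null_seq_star/urepr_uclass.
Qed.

Lemma uclass_surj (x : ultrapower) : exists a, x = uclass a.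
Proof. by exists (urepr x); rewrite ureprK. Qed.

Lemma uscalerA (c d : C) x : uscale c (uscale d x) = uscale (c * d) x.
Proof. by have [a ->] := uclass_surj x; rewrite !uscaleE scalerA. Qed.

Lemma uscale1r : left_id 1 uscale.
Proof. by move=> x; have [a ->] := uclass_surj x; rewrite uscaleE scale1r. Qed.

Lemma uscalerDr : right_distributive uscale +%R.
Proof.
move=> c x y; have [a ->] := uclass_surj x; have [b ->] := uclass_surj y.
by rewrite !uscaleE -!uclassD uscaleE scalerDr.
Qed.

Lemma uscalerDl x : {morph uscale^~ x : c d / c + d}.
Proof.
move=> c d; have [a ->] := uclass_surj x.
by rewrite !uscaleE -uclassD scalerDl.
Qed.

HB.instance Definition _ := GRing.Zmodule_isLmodule.Build C ultrapower
  uscalerA uscale1r uscalerDr uscalerDl.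

Lemma umulA : associative umul.
Proof.
move=> x y z; have [a ->] := uclass_surj x; have [b ->] := uclass_surj y.
by have [c ->] := uclass_surj z; rewrite !umulE amulA.
Qed.

Lemma umulDl : left_distributive umul +%R.
Proof.
move=> x y z; have [a ->] := uclass_surj x; have [b ->] := uclass_surj y.
by have [c ->] := uclass_surj z; rewrite -uclassD !umulE -uclassD amulDl.
Qed.

Lemma umulDr : right_distributive umul +%R.
Proof.
move=> x y z; have [a ->] := uclass_surj x; have [b ->] := uclass_surj y.
by have [c ->] := uclass_surj z; rewrite -uclassD !umulE -uclassD amulDr.
Qed.

Lemma umulZl (c : C) (x y : ultrapower) : umul (c *: x) y = c *: umul x y.
Proof.
have [a ->] := uclass_surj x; have [b ->] := uclass_surj y.
by rewrite /GRing.scale/= umulE !uscaleE umulE amulZl.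
Qed.

Lemma umulZr (c : C) (x y : ultrapower) : umul x (c *: y) = c *: umul x y.
Proof.
have [a ->] := uclass_surj x; have [b ->] := uclass_surj y.
by rewrite /GRing.scale/= umulE !uscaleE umulE amulZr.
Qed.

Lemma ustarK : involutive ustar.
Proof. by move=> x; have [a ->] := uclass_surj x; rewrite !ustarE starK. Qed.

Lemma ustarD : {morph ustar : x y / x + y}.
Proof.
move=> x y; have [a ->] := uclass_surj x; have [b ->] := uclass_surj y.
by rewrite -uclassD !ustarE -uclassD starD.
Qed.

Lemma ustarZ (c : C) (x : ultrapower) : ustar (c *: x) = c^* *: ustar x.
Proof.
have [a ->] := uclass_surj x.
by rewrite /GRing.scale/= ustarE !uscaleE ustarE starZ.
Qed.

Lemma ustarM (x y : ultrapower) : ustar (umul x y) = umul (ustar y) (ustar x).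
Proof.
have [a ->] := uclass_surj x; have [b ->] := uclass_surj y.
by rewrite !(umulE, ustarE) starM.
Qed.

HB.instance Definition _ := Lmodule_isStarAlgebra.Build R ultrapower
  umulA umulDl umulDr umulZl umulZr ustarK ustarD ustarZ ustarM.

Definition iota_ultrapower (a : A) : ultrapower := uclass (linfty_cst a).

(* A limit trace is determined by the sequence t of traces: the condition says
   that tau maps the class of (a_n) to the limit of t_n(a_n) along omega. *)
Definition limit_traces : set (ultrapower -> C) :=
  [set tau | exists2 t : nat -> A -> C, (forall n, traces A (t n)) &
    forall a : linfty A,
      (fun n => t n (a n)) @ fu_filter omega --> tau (uclass a)].

(* Projections of A^omega in the relative commutant of A which sum to the unit
   of A^omega. *)
Definition central_partition (n : nat) (p : 'I_n -> ultrapower) :=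
  [/\ forall i, is_projection (p i),
      forall i, commutant (range iota_ultrapower) (p i) &
      is_unit_element (\sum_(i < n) p i)].

End uniform_tracial_ultrapower.

(* Only meaningful for separable A with T(A) compact and non-empty. *)
Definition uniform_property_Gamma (R : realType) (omega : free_ultrafilter)
    (A : cstarType R) :=
  forall n : nat, (0 < n)%N ->
    exists p : 'I_n -> ultrapower omega A,
      central_partition p /\
      forall (a : A) (tau : ultrapower omega A -> Cplx R) (i : 'I_n),
        limit_traces tau ->
        tau (iota_ultrapower omega a ** p i) =
          n%:R^-1 * tau (iota_ultrapower omega a).

(* Main.v *)
Require Import Defs.
From HB Require Import structures.
From mathcomp Require Import all_boot all_order all_algebra.
From mathcomp Require Import complex ring lra.
From mathcomp Require Import all_classical all_reals all_analysis.

Set Implicit Arguments.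
Unset Strict Implicit.
Unset Printing Implicit Defensive.

Import Order.TTheory GRing.Theory Num.Theory.
Import numFieldNormedType.Exports.
Local Open Scope classical_set_scope.
Local Open Scope ring_scope.

(** The two conditions differ only by the element a of A inside the trace.

    From left to right, let a run through contractions of A with tau(a) close
    to 1, which exist since tau restricts to a state of A.  They tend to the unit e
    of A^omega in the 2-norm of tau, as the square of the norm of e - a is at most
    tau(e) - 2 tau(a) + 1 and tau(e) <= 1.  Hence tau(p_i) is the limit of
    tau(a p_i) = tau(a)/n, that is 1/n ([trace_of_projection]).

    From right to left, suppose first that tau comes from a sequence of extreme
    traces.  The extreme boundary being compact, tau restricts to an extreme trace
    of A.  As p_i is a projection commuting with A, the functional a |-> tau(a p_i)
    is tracial, positive, of norm tau(p_i) = 1/n, and likewise for e - p_i with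
    1 - 1/n, when n > 1.  So the restriction of tau is a convex combination of two traces, and
    extremality makes both of them equal to it: tau(a p_i) = tau(a)/n
    ([extreme_cut]).  For an arbitrary sequence of traces t_k, write
    tau(a p_i) - tau(a)/n as the limit of t_k(w_k) with w_k in A.  A linear functional
    on T(A) attains its maximum at an extreme point ([extreme_trace_max], where
    separability allows to maximize along a sequence of functionals), so that
    |t_k(w_k)| <= |s_k(w_k)| with s_k extreme, and the limit of s_k(w_k) is 0 by the
    first case.

    Two facts about traces on an algebra without unit are used: every
    sequence of traces induces a limit trace, that is, t(x) is controlled by the
    2-norm of x ([trace_le_seminorm2_sa]); and tau(e) <= 1
    ([limit_trace_unit_le1]).  They are usually read off from an approximate unit
    or from the functional calculus.  Both are obtained here from one elementary
    observation: for x self-adjoint and d imaginary, 1 + d x multiplies norms by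
    at most (1 + |d|^2 |x|^2)^(1/2), so that its powers up to the order 1/|d|^2
    stay bounded. *)

(** * The modulus of a complex number, as a real number *)

Section complex_modulus.
Variable R : realType.
Local Notation C := (Cplx R).
Implicit Types (x y z : C) (r s : R).

Definition modulus z : R := re `|z|.

Lemma modulusE z : (modulus z)%:C%C = `|z|.
Proof. by rewrite /modulus reK. Qed.

Lemma modulus_ge0 z : 0 <= modulus z.
Proof. exact/re_ge0. Qed.

Lemma modulusP z r : (modulus z <= r) = (`|z| <= r%:C%C).
Proof. by rewrite -real_le modulusE. Qed.

Lemma modulusM x y : modulus (x * y) = modulus x * modulus y.
Proof.
apply: complexI; rewrite (rmorphM (real_complex R)) /=.
by rewrite !modulusE normrM.
Qed.

Lemma modulusD x y : modulus (x + y) <= modulus x + modulus y.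
Proof. by rewrite modulusP rmorphD /= !modulusE ler_normD. Qed.

Lemma modulusN x : modulus (- x) = modulus x.
Proof. by rewrite /modulus normrN. Qed.

Lemma modulusB x y : modulus x - modulus y <= modulus (x - y).
Proof. by rewrite lerBlDr -{1}(subrK y x) modulusD. Qed.

Lemma modulus_real r : modulus r%:C%C = `|r|.
Proof. by apply: complexI; rewrite modulusE normc_def /= expr0n addr0 sqrtr_sqr. Qed.

Lemma modulus0 : modulus 0 = 0.
Proof. by rewrite /modulus normr0. Qed.

Lemma modulus_eq0 z : modulus z = 0 -> z = 0.
Proof. by move=> z0; apply/eqP; rewrite -normr_eq0 -modulusE z0. Qed.

Lemma modulus_nat n : modulus n%:R = n%:R.
Proof.
by rewrite -(rmorph_nat (real_complex R)) modulus_real ger0_norm.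
Qed.

Lemma re_le_modulus z : re z <= modulus z.
Proof.
case: z => a b; rewrite -lecR modulusE normc_def lecR /re/=.
rewrite (le_trans (ler_norm a))// -sqrtr_sqr ler_wsqrtr// lerDl sqr_ge0//.
Qed.

Lemma re_ge0_modulus z : 0 <= z -> re z = modulus z.
Proof. by move=> z0; rewrite /modulus ger0_norm. Qed.

Lemma reMr r z : re (r%:C%C * z) = r * re z.
Proof. by case: z => a b; rewrite /re /= mul0r subr0. Qed.

Lemma modulus_sq z : `|z| ^+ 2 = (modulus z ^+ 2)%:C%C.
Proof. by rewrite rmorphXn /= modulusE. Qed.

Lemma rotate_to_modulus z :
  exists2 c : C, `|c| = 1 & c * z = (modulus z)%:C%C.
Proof.
have [->|z0] := eqVneq z 0.
  by exists 1; rewrite ?normr1// mul1r modulus0.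
exists (z^* / `|z|).
  by rewrite normrM norm_conjC normfV normr_id mulfV// normr_eq0.
by rewrite modulusE mulrAC [_^* * _]mulrC -normCK expr2 mulfK// normr_eq0.
Qed.

Lemma eq_of_modulus_small z w (K : R) :
  (forall d, 0 < d -> modulus (z - w) <= d * K) -> z = w.
Proof.
move=> h; apply/eqP; rewrite -subr_eq0; apply/eqP/modulus_eq0/eqP.
rewrite eq_le modulus_ge0 andbT; apply/ler_addgt0Pr => d d0; rewrite add0r.
have K0 : 0 < `|K| + 1 by rewrite ltr_wpDl.
apply: le_trans (h (d / (`|K| + 1)) _) _; first by rewrite divr_gt0.
rewrite -mulrA ler_piMr ?(ltW d0)// mulrC ler_pdivrMr// mul1r.
by rewrite (le_trans (ler_norm K))// lerDl.
Qed.

End complex_modulus.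

(** * Positive tracial functionals and the Cauchy-Schwarz inequality *)

Section positive_tracial_functionals.
Context {R : realType} {S : starAlgType R}.
Local Notation C := (Cplx R).

(** What survives of a trace on a *-algebra without a norm; limit traces on the
    ultrapower are of this kind. *)
Definition positive_tracial (f : S -> C) :=
  [/\ scalar f, forall a, 0 <= f (star a ** a) &
      forall a b, f (a ** b) = f (b ** a)].

Variables (f : S -> C) (ptf : positive_tracial f).

Lemma ptD a b : f (a + b) = f a + f b.
Proof.
by have [sf _ _] := ptf; have := sf 1 a b; rewrite scale1r mul1r.
Qed.

Lemma pt0 : f 0 = 0.
Proof. by apply: (addrI (f 0)); rewrite -ptD !addr0. Qed.

Lemma ptZ c a : f (c *: a) = c * f a.
Proof.
by have [sf _ _] := ptf; have := sf c a 0; rewrite pt0 !addr0.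
Qed.

Lemma ptN a : f (- a) = - f a.
Proof. by rewrite -scaleN1r ptZ mulN1r. Qed.

Lemma ptB a b : f (a - b) = f a - f b.
Proof. by rewrite ptD ptN. Qed.

Lemma pt_ge0 a : 0 <= f (star a ** a).
Proof. by have [] := ptf. Qed.

Lemma ptC a b : f (a ** b) = f (b ** a).
Proof. by have [] := ptf. Qed.

Lemma pt_expand c x y :
  f (star (x + c *: y) ** (x + c *: y)) =
  f (star x ** x) + c * f (star x ** y) + c^* * f (star y ** x)
  + `|c| ^+ 2 * f (star y ** y).
Proof.
rewrite starD starZ !(amulDl, amulDr, amulZl, amulZr) !(ptD, ptZ) normCK.
by ring.
Qed.

(** A sesquilinear form with real diagonal is hermitian, by polarization
    along 1 and i. *)
Lemma pt_hermitian x y : f (star y ** x) = (f (star x ** y))^*.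
Proof.
set u := f (star x ** y); set v := f (star y ** x).
have e c : (c * u + c^* * v)^* = c * u + c^* * v.
  have -> : c * u + c^* * v = f (star (x + c *: y) ** (x + c *: y)) -
      f (star x ** x) - `|c| ^+ 2 * f (star y ** y).
    by rewrite pt_expand -/u -/v; ring.
  apply/CrealP; rewrite !rpredB// ?ger0_real ?pt_ge0//.
  by rewrite mulr_ge0 ?exprn_ge0 ?pt_ge0.
have := e 1; rewrite conjC1 !mul1r rmorphD => e1.
have := e 'i; rewrite conjCi mulNr.
rewrite (rmorphB (@Num.conj C)) 2!(rmorphM (@Num.conj C)) /= !conjCi => e2.
have i0 : ('i : C) != 0 by exact: neq0Ci.
have {}e2 : - u^* + v^* = u - v.
  by apply: (mulfI i0); rewrite mulrDr mulrN [RHS]mulrBr -e2; ring.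
have h : v + v = u^* + u^*.
  have -> : v + v = (u + v) - (u - v) by ring.
  by rewrite -e1 -e2; ring.
have two : (2 : C) != 0 by rewrite pnatr_eq0.
by apply: (mulfI two); rewrite !mulr_natl !mulr2n.
Qed.

Definition seminorm2 (x : S) : R := Num.sqrt (re (f (star x ** x))).

Lemma seminorm2_ge0 x : 0 <= seminorm2 x.
Proof. exact: sqrtr_ge0. Qed.

Lemma seminorm2_sq x : seminorm2 x ^+ 2 = re (f (star x ** x)).
Proof. by rewrite sqr_sqrtr// re_ge0// pt_ge0. Qed.

Lemma seminorm2_leP x r : 0 <= r -> re (f (star x ** x)) <= r ^+ 2 -> seminorm2 x <= r.
Proof.
by move=> r0 h; rewrite -[r]ger0_norm// -sqrtr_sqr ler_wsqrtr.
Qed.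

Lemma cauchy_schwarz x y : modulus (f (star x ** y)) <= seminorm2 x * seminorm2 y.
Proof.
set B := f _; pose m := modulus B.
pose a := re (f (star x ** x)); pose b := re (f (star y ** y)).
have quad s : 0 <= a - 2 * s * m ^+ 2 + s ^+ 2 * m ^+ 2 * b.
  (* The phase of B is absorbed in c, which leaves a real quadratic in s. *)
  pose c : C := - (s%:C%C * B^*).
  have := pt_ge0 (x + c *: y); rewrite pt_expand (pt_hermitian x y) -/B.
  have -> : c * B = (- (s * m ^+ 2))%:C%C.
    rewrite /c mulNr -mulrA [B^* * B]mulrC -normCK modulus_sq -rmorphM /=.
    by rewrite -rmorphN.
  have -> : c^* * B^* = (- (s * m ^+ 2))%:C%C.
    rewrite /c rmorphN rmorphM /= conjCK (_ : (s%:C%C : C)^* = s%:C%C); last first.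
      by apply/CrealP; rewrite complex_real.
    by rewrite mulNr -mulrA -normCK modulus_sq -rmorphM /= -rmorphN.
  have -> : `|c| ^+ 2 = (s ^+ 2 * m ^+ 2)%:C%C.
    rewrite modulus_sq /c modulusN modulusM modulus_real.
    rewrite [modulus B^*](_ : _ = m) ?exprMn ?real_normK ?num_real//.
    by rewrite /m /modulus norm_conjC.
  move=> /re_ge0; rewrite !reD reMr; rewrite -/a -/b.
  have reC (r : R) : re (r%:C%C : C) = r by [].
  rewrite !reC; lra.
have a0 : 0 <= a by apply/re_ge0/pt_ge0.
have b0 : 0 <= b by apply/re_ge0/pt_ge0.
have m0 : 0 <= m by exact: modulus_ge0.
suff h : m ^+ 2 <= a * b.
  rewrite -(@ler_sqr R) ?nnegrE ?mulr_ge0 ?seminorm2_ge0//.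
  by rewrite exprMn !seminorm2_sq.
have [b0'|b0'] := eqVneq b 0.
  rewrite b0' mulr0 leNgt; apply/negP => mp.
  have m_neq0 : m != 0 by apply: contraTneq mp => ->; rewrite expr0n ltxx.
  (* At this s the quadratic, affine when b = 0, takes the value -1. *)
  have := quad ((a + 1) / (2 * m ^+ 2)); rewrite b0' mulr0 addr0.
  rewrite (_ : 2 * _ * _ = a + 1); last by field.
  by lra.
have := quad b^-1.
rewrite (_ : _ - _ + _ = a - m ^+ 2 / b); last by field.
by rewrite subr_ge0 ler_pdivrMr// lt0r b0'.
Qed.

End positive_tracial_functionals.
Arguments seminorm2 {R S} f x.

(** * Almost unitary elements 1 + d x, and traces of self-adjoint elements *)

Section unitary_powers.
Context {R : realType}.
Local Notation C := (Cplx R).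

(** [upow x d k] is (1 + d x)^k - 1, computed without a unit. *)
Fixpoint upow (S : starAlgType R) (x : S) (d : C) (k : nat) : S :=
  if k is k'.+1 then
    upow x d k' + d *: x + d *: (x ** upow x d k')
  else 0.

Lemma upow_unit (S : starAlgType R) (e : S) (d : C) k :
  e ** e = e -> upow e d k = ((1 + d) ^+ k - 1) *: e.
Proof.
move=> ee; elim: k => [|k IH] /=; first by rewrite expr0 subrr scale0r.
by rewrite IH amulZr ee scalerA -!scalerDl exprS; congr (_ *: _); ring.
Qed.

Variable A : cstarType R.
Implicit Types x y b : A.

Section bounds.
Variables (x : A) (d r : C).
Hypotheses (xsa : star x = x) (d_imag : d^* = - d) (r0 : 0 <= r)
  (hr : 1 + `|d| ^+ 2 * `|x| ^+ 2 <= r ^+ 2).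

(** As x is self-adjoint and d imaginary, (1 + d x)^* (1 + d x) is
    1 + |d|^2 x^2, so that 1 + d x is almost isometric for small d.  This is what
    replaces the functional calculus. *)
Lemma upow_step b : `|b + d *: (x ** b)| <= r * `|b|.
Proof.
rewrite -(@ler_pXn2r _ 2) ?nnegrE ?mulr_ge0// -cnorm_star.
have -> : star (b + d *: (x ** b)) ** (b + d *: (x ** b)) =
    star b ** b + `|d| ^+ 2 *: (star (x ** b) ** (x ** b)).
  rewrite starD starZ starM xsa d_imag.
  rewrite !(amulDl, amulDr, amulZl, amulZr) scalerDr scalerA -!amulA.
  by rewrite normCK d_imag mulrN mulNr scaleNr -addrA addNKr.
rewrite (le_trans (ler_normD _ _))// normrZ !cnorm_star.
rewrite [`| `|d| ^+ 2|]ger0_norm ?exprn_ge0// exprMn.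
apply: (@le_trans _ _ ((1 + `|d| ^+ 2 * `|x| ^+ 2) * `|b| ^+ 2)).
  rewrite mulrDl mul1r lerD2l -mulrA ler_wpM2l ?exprn_ge0// -exprMn.
  by rewrite lerXn2r ?nnegrE ?mulr_ge0// cnormM.
by rewrite ler_wpM2r ?exprn_ge0.
Qed.

Lemma upow_act k b : `|b + upow x d k ** b| <= r ^+ k * `|b|.
Proof.
elim: k => [|k IH] /=; first by rewrite amul0r addr0 expr0 mul1r.
set y := upow x d k in IH *.
have -> : b + (y + d *: x + d *: (x ** y)) ** b =
    (b + y ** b) + d *: (x ** (b + y ** b)).
  by rewrite !amulDl amulDr !amulZl scalerDr !addrA -amulA.
by rewrite (le_trans (upow_step _))// exprS -mulrA ler_wpM2l.
Qed.

(** The action of y = [upow x d k] on the algebra controls its norm, by the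
    C*-identity applied to the product of y with its adjoint. *)
Lemma upow_norm k : `|upow x d k| <= 1 + r ^+ k.
Proof.
set y := upow x d k.
have [->|y0] := eqVneq y 0; first by rewrite normr0 addr_ge0 ?exprn_ge0.
have ny : 0 < `|star y| by rewrite norm_star normr_gt0.
rewrite -(ler_pM2r ny) norm_star -expr2 -(norm_star y) -cnorm_star starK.
have -> : y ** star y = (star y + y ** star y) - star y by rewrite addrAC subrr add0r.
rewrite (le_trans (ler_normB _ _))// mulrDl mul1r addrC lerD2l.
exact: upow_act.
Qed.

End bounds.

Lemma trace_positive_tracial (t : A -> C) : is_trace t -> positive_tracial t.
Proof. by case=> -[]. Qed.

Lemma seminorm2_le_norm (t : A -> C) a : is_trace t -> seminorm2 t a <= re `|a|.
Proof.
move=> tt; apply: seminorm2_leP; first exact/re_ge0.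
have := re_le (tr_sq_norm tt a).
by rewrite -[X in re (X ^+ 2)]reK// -rmorphXn.
Qed.

(** The first order term of [upow x d k] is k d x; the other terms are products
    with x, and Cauchy-Schwarz bounds the trace on these. *)
Lemma trace_upow (t : A -> C) x d (B : R) k :
  is_trace t -> star x = x ->
  (forall j, (j <= k)%N -> `|upow x d j| <= B%:C%C) ->
  modulus (t (upow x d k) - k%:R * d * t x) <= k%:R * modulus d * seminorm2 t x * B.
Proof.
move=> tt xsa; have pt := trace_positive_tracial tt.
elim: k => [|k IH] hB /=.
  by rewrite (tr0 tt) !mul0r subr0 modulus0.
set y := upow x d k in IH *.
have -> : t (y + d *: x + d *: (x ** y)) - k.+1%:R * d * t x =
    (t y - k%:R * d * t x) + d * t (x ** y).
  by rewrite !(trD tt) !(trZ tt) -natr1; ring.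
rewrite (le_trans (modulusD _ _))//.
rewrite -natr1 !mulrDl lerD//; first by apply: IH => j /leqW; exact: hB.
rewrite mul1r modulusM -mulrA ler_wpM2l ?modulus_ge0//.
rewrite -{1}xsa (le_trans (cauchy_schwarz pt x y))//.
rewrite ler_wpM2l ?seminorm2_ge0// (le_trans (seminorm2_le_norm y tt))//.
by rewrite -lecR reK// hB// leqnSn.
Qed.

Lemma imag_conj (s : R) : ('i * s%:C%C : C)^* = - ('i * s%:C%C).
Proof.
rewrite rmorphM /= conjCi mulNr; congr (- (_ * _)).
by apply/CrealP; rewrite complex_real.
Qed.

Lemma modulus_imag (s : R) : 0 <= s -> modulus ('i * s%:C%C : C) = s.
Proof.
move=> s0; rewrite modulusM modulus_real ger0_norm//.
by rewrite /modulus normCi mul1r.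
Qed.

(** In a unital algebra, Cauchy-Schwarz against the unit bounds |t x| by the
    2-norm of x.  Here the same is obtained up to a constant: for d = i/(n|x|) the
    powers (1 + d x)^j with j <= n^2 act with norm at most e, so that the trace of
    [upow x d (n ^ 2)] stays bounded, while its first order term n^2 d t(x) grows
    like n and its other terms are at most of the order of n times the 2-norm. *)
Lemma trace_le_seminorm2_sa (t : A -> C) x : is_trace t -> star x = x ->
  modulus (t x) <= (1 + expR 1) * seminorm2 t x.
Proof.
move=> tt xsa.
have [->|x0] := eqVneq x 0.
  by rewrite (tr0 tt) modulus0 mulr_ge0 ?seminorm2_ge0// addr_ge0// expR_ge0.
pose M := re `|x|; pose B : R := 1 + expR 1.
have M0 : 0 < M by rewrite -ltcR reK// normr_gt0.
have key n : modulus (t x) <= B * (M / n.+1%:R + seminorm2 t x).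
  pose s : R := (n.+1%:R * M)^-1.
  pose r : R := Num.sqrt (1 + (n.+1%:R ^+ 2)^-1).
  have s0 : 0 < s by rewrite invr_gt0 mulr_gt0.
  have [d d_imag md] : exists2 d : C, d^* = - d & modulus d = s.
    by exists ('i * s%:C%C); rewrite ?imag_conj// modulus_imag// ltW.
  have r1 : 1 <= r.
    by rewrite -[leLHS]sqrtr1 ler_wsqrtr// lerDl invr_ge0 exprn_ge0.
  have r0 : 0 <= r by rewrite (le_trans _ r1).
  have rsq : r ^+ 2 = 1 + (n.+1%:R ^+ 2)^-1.
    by rewrite sqr_sqrtr// addr_ge0// invr_ge0 exprn_ge0.
  pose k := (n.+1 ^ 2)%N.
  have rk j : (j <= k)%N -> r ^+ j <= expR 1.
    move=> jk; apply: (@le_trans _ _ (r ^+ (2 * k))).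
      by apply: ler_weXn2l => //; rewrite (leq_trans jk)// leq_pmull.
    rewrite exprM rsq; apply: (@le_trans _ _ (expR (n.+1%:R ^+ 2)^-1 ^+ k)).
      by rewrite lerXn2r ?nnegrE ?expR_ge0 ?expR_ge1Dx// addr_ge0// invr_ge0 exprn_ge0.
    rewrite -expRM_natl -[k%:R]/((n.+1 ^ 2)%:R) natrX mulfV// expf_neq0// pnatr_eq0//.
  have hB j : (j <= k)%N -> `|upow x d j| <= B%:C%C.
    move=> jk; apply: (@le_trans _ _ (1 + (r%:C%C) ^+ j)).
      apply: upow_norm => //; first by rewrite lecR.
      rewrite !modulus_sq -/(modulus _) md.
      rewrite -[`|x|]reK// -!rmorphXn /= -rmorphM /= rsq.
      rewrite -(rmorph1 (real_complex R)) -rmorphD lecR -/M.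
      rewrite lerD2l -exprMn /s invfM mulfVK ?gt_eqF// exprVn//.
    by rewrite -rmorphXn /B rmorphD rmorph1 lerD2l lecR rk.
  have := trace_upow tt xsa hB; rewrite md.
  have := modulusB (k%:R * d * t x) (t (upow x d k)).
  rewrite -[X in _ <= X]modulusN opprB !modulusM modulus_nat md.
  have := re_le_modulus (t (upow x d k)).
  have : modulus (t (upow x d k)) <= B.
    by rewrite modulusP (le_trans (tr_norm tt _))// hB.
  have ks : k%:R * s = n.+1%:R / M.
    by rewrite /k natrX /s; field; rewrite gt_eqF//=.
  rewrite ks => h1 _ h2 h3.
  have nM : 0 < n.+1%:R / M by rewrite divr_gt0.
  rewrite -(ler_pM2l nM).
  have -> : n.+1%:R / M * (B * (M / n.+1%:R + seminorm2 t x)) =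
     B + n.+1%:R / M * seminorm2 t x * B.
    by field; rewrite gt_eqF//=.
  rewrite -lerBlDl; apply: le_trans h3; apply: le_trans h2.
  by rewrite lerD2l lerN2.
suff : B * (M / n.+1%:R + seminorm2 t x) @[n --> \oo] --> B * (0 + seminorm2 t x).
  rewrite add0r => lim; rewrite -(cvg_lim _ lim)//.
  by apply: limr_ge; [exact: (cvgP _ lim)|exact: nearW].
apply: cvgM; first exact: cvg_cst.
apply: cvgD; last exact: cvg_cst.
rewrite -(mulr0 M); apply: cvgM; first exact: cvg_cst.
exact: cvg_harmonic.
Qed.

End unitary_powers.

(** * Limits along an ultrafilter *)

Section limits.
Context {R : realType}.
Local Notation C := (Cplx R).

Lemma modulus_cvgP {T : Type} (F : set_system T) {FF : Filter F} (z : T -> C) (l : C) :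
  z @ F --> l <-> (fun n => modulus (l - z n)) @ F --> (0 : R).
Proof.
split=> [/cvgrPdist_lt zl|zl].
  apply/cvgrPdist_lt => e e0.
  have := zl e%:C%C; rewrite ltcR => /(_ e0); apply: filterS => n.
  by rewrite -modulusE ltcR sub0r normrN ger0_norm// modulus_ge0.
apply/cvgrPdist_lt => e e0.
have ee : (re e)%:C%C = e by rewrite reK// ltW.
have e0' : 0 < re e by rewrite -ltcR ee.
move/cvgrPdist_lt: zl => /(_ _ e0'); apply: filterS => n.
by rewrite sub0r normrN ger0_norm ?modulus_ge0// -ltcR modulusE ee.
Qed.

Lemma cvg_modulus {T : Type} (F : set_system T) {FF : Filter F} (z : T -> C) (l : C) :
  z @ F --> l -> (fun n => modulus (z n)) @ F --> modulus l.
Proof.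
move=> /modulus_cvgP/cvgrPdist_lt zl; apply/cvgrPdist_lt => e /zl.
apply: filterS => n; rewrite sub0r normrN ger0_norm ?modulus_ge0//.
apply: le_lt_trans; rewrite ler_norml modulusB andbT lerNl.
by rewrite opprB -[leRHS]modulusN opprB modulusB.
Qed.

Lemma cvg_re {T : Type} (F : set_system T) {FF : Filter F} (z : T -> C) (l : C) :
  z @ F --> l -> (fun n => re (z n)) @ F --> re l.
Proof.
move=> /modulus_cvgP/cvgrPdist_lt zl; apply/cvgrPdist_lt => e /zl.
apply: filterS => n; rewrite sub0r normrN ger0_norm ?modulus_ge0//.
apply: le_lt_trans; rewrite -reN -reD ler_norml re_le_modulus andbT lerNl -reN.
by rewrite -modulusN re_le_modulus.
Qed.

Lemma cvg_real_complex {T : Type} (F : set_system T) {FF : Filter F} (u : T -> R) (l : R) :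
  u @ F --> l -> (fun n => (u n)%:C%C : C) @ F --> (l%:C%C : C).
Proof.
move=> /cvgrPdist_lt ul; apply/modulus_cvgP/cvgrPdist_lt => e /ul.
by apply: filterS => n; rewrite sub0r normrN -rmorphB modulus_real normr_id.
Qed.

Lemma re_mulNi (z : C) : re (- 'i * z) = complex.Im z.
Proof.
have -> : (- 'i : C) = (0 -i* 1)%C by apply/eqP; rewrite eq_complex /= oppr0 !eqxx.
by case: z => a b; rewrite /re /= mul0r sub0r mulN1r opprK.
Qed.

End limits.

Lemma ultra_fmap (T U : Type) (f : T -> U) (F : set_system T) :
  UltraFilter F -> UltraFilter (f @ F).
Proof.
move=> FU; split=> [|G GF FG]; first exact: fmap_proper_filter.
rewrite predeqE => B; split=> [GB|/FG//].
have [//|FnB] := in_ultra_setVsetC (f @^-1` B) FU.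
have GnB : G (~` B) by apply: FG.
by have [x []] := filter_ex (filterI GB GnB).
Qed.

Section ultralimits.
Context {R : realType} (omega : free_ultrafilter).
Local Notation C := (Cplx R).

Lemma cofinite_omega : fu_filter omega --> \oo.
Proof.
move=> B [N _ NB]; apply: filterS NB _ => {B}.
elim: N => [|N IH]; first by apply: filterS filterT.
have FN : fu_filter omega (~` [set N]).
  by have [/fu_free//|] := in_ultra_setVsetC [set N] (fu_ultra omega).
apply: filterS (filterI IH FN) => n /= [Nn nN].
by rewrite ltn_neqAle Nn andbT eq_sym; apply/eqP.
Qed.

Lemma cvg_omega {T : topologicalType} (u : nat -> T) (l : T) :
  u @ \oo --> l -> u @ fu_filter omega --> l.
Proof. by apply: cvg_trans; apply: cvg_app; exact: cofinite_omega. Qed.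

Lemma real_ultralimit (u : nat -> R) (M : R) :
  (forall n, `|u n| <= M) -> exists l : R, u @ fu_filter omega --> l.
Proof.
move=> uM; have := @segment_compact R (- M) M; rewrite compact_ultra.
move=> /(_ (u @ fu_filter omega) _)[||l [_ ul]]; last by exists l.
  exact: ultra_fmap.
apply: (@filterS _ (fu_filter omega) _ setT) => [n _ /=|]; last exact: filterT.
by rewrite in_itv/= -ler_norml uM.
Qed.

Lemma ultralimit (z : nat -> C) (M : R) :
  (forall n, modulus (z n) <= M) -> exists l : C, z @ fu_filter omega --> l.
Proof.
move=> zM.
have part (w : nat -> C) : (forall n, modulus (w n) <= M) ->
    exists l : R, (fun n => re (w n)) @ fu_filter omega --> l.
  move=> wM; apply: (@real_ultralimit _ M) => n.
  rewrite ler_norml (le_trans (re_le_modulus _))// andbT lerNl -reN.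
  by rewrite (le_trans (re_le_modulus _))// modulusN.
have [a za] := part z zM.
have izM n : modulus (- 'i * z n) <= M.
  by rewrite modulusM modulusN [modulus 'i]/modulus normCi mul1r.
have [b zb] := part _ izM.
exists (a +i* b)%C; apply/modulus_cvgP.
apply: (@squeeze_cvgr _ _ _ _ (fun=> 0)
  (fun n => `|a - re (z n)| + `|b - re (- 'i * z n)|)).
- apply: nearW => n; rewrite modulus_ge0/= re_mulNi.
  case: (z n) => x y; rewrite /re/=.
  have -> : ((a +i* b) - (x +i* y) : C)%C = (a - x)%:C%C + 'i * (b - y)%:C%C.
    apply/eqP; rewrite [('i : C)](_ : _ = (0 +i* 1)%C)// eq_complex /=.
    by apply/andP; split; apply/eqP; ring.
  rewrite (le_trans (modulusD _ _))// modulusM !modulus_real.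
  by rewrite /modulus normCi mul1r.
- exact: cvg_cst.
- rewrite -[0](addr0 0); apply: cvgD; apply/cvgr0Pnorm_lt => e e0.
    by move/cvgrPdist_lt: za => /(_ _ e0); apply: filterS => n; rewrite normr_id.
  by move/cvgrPdist_lt: zb => /(_ _ e0); apply: filterS => n; rewrite normr_id.
Qed.

Lemma cplx_cvg_unique (z : nat -> C) (l l' : C) :
  z @ fu_filter omega --> l -> z @ fu_filter omega --> l' -> l = l'.
Proof. by move=> zl zl'; apply: cvg_unique zl zl'; exact: norm_hausdorff. Qed.

End ultralimits.

(** * Limit traces *)

Section limit_trace_theory.
Context {R : realType} {omega : free_ultrafilter} {A : cstarType R}.
Local Notation C := (Cplx R).
Local Notation U := (ultrapower omega A).
Local Notation uclass := (@uclass R omega A).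

Definition induced_by (t : nat -> A -> C) (tau : U -> C) :=
  forall a : linfty A, (fun n => t n (a n)) @ fu_filter omega --> tau (uclass a).

(** A sequence which is null for the uniform 2-norm is null for every sequence of
    traces; this is what makes the functionals of [limit_trace_exists] well
    defined on the quotient. *)
Lemma trace_null (t : nat -> A -> C) (a : linfty A) :
  (forall n, is_trace (t n)) -> a \in null_seq omega ->
  (fun n => t n (a n)) @ fu_filter omega --> (0 : C).
Proof.
move=> tt a0.
have selfadj (h : linfty A) : star h = h -> h \in null_seq omega ->
    (fun n => t n (h n)) @ fu_filter omega --> (0 : C).
  move=> hs /null_seqP h0; apply/modulus_cvgP.
  apply: (@squeeze_cvgr _ _ _ _ (fun=> 0)
    (fun n => (1 + expR 1) * norm2 (traces A) (h n))).
  - apply: nearW => n; rewrite modulus_ge0/= sub0r modulusN.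
    have hn : star (h n) = h n by rewrite -[in RHS]hs.
    rewrite (le_trans (trace_le_seminorm2_sa (tt n) hn))// ler_wpM2l ?addr_ge0 ?expR_ge0//.
    exact: norm2_ubound.
  - exact: cvg_cst.
  - by rewrite -(mulr0 (1 + expR 1)); apply: cvgM; first exact: cvg_cst.
have i0 : ('i : C) != 0 by exact: neq0Ci.
have two : (2 : C) != 0 by rewrite pnatr_eq0.
pose c : C := 2^-1; pose d : C := (2 * 'i)^-1.
have cc : c^* = c by rewrite /c fmorphV /= rmorph_nat.
have dc : d^* = - d by rewrite /d fmorphV rmorphM /= rmorph_nat conjCi mulrN invrN.
pose h := c *: (a + star a); pose k := d *: (a - star a).
have sa0 := null_seq_star a0.
have h0 : h \in null_seq omega by apply/null_seqZ/rpredD.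
have k0 : k \in null_seq omega by apply/null_seqZ/rpredB.
have hs : star h = h by rewrite /h starZ starD starK addrC cc.
have ks : star k = k.
  rewrite /k -[- star a]scaleN1r starZ starD starZ starK dc rmorphN1 !scaleN1r.
  by rewrite scaleNr -scalerN opprD opprK addrC.
have e : a = h + 'i *: k.
  rewrite /h /k scalerA (_ : 'i * d = c); last by rewrite /c /d; field; rewrite i0.
  rewrite -scalerDr addrACA subrr addr0 -mulr2n -scaler_nat scalerA mulVf//.
  by rewrite scale1r.
have -> : (fun n => t n (a n)) = (fun n => t n (h n) + 'i * t n (k n)).
  by apply/funext => n; rewrite -(trZ (tt n)) -(trD (tt n)) {1}e.
rewrite -[0 in X in _ --> X](_ : 0 + 'i * 0 = 0); last by rewrite mulr0 addr0.
by apply: cvgD; [exact: selfadj|apply: cvgM; [exact: cvg_cst|exact: selfadj]].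
Qed.

Lemma limit_trace_exists (t : nat -> A -> C) :
  (forall n, is_trace (t n)) -> exists tau, induced_by t tau.
Proof.
move=> tt.
have ex (a : linfty A) : exists l : C, (fun n => t n (a n)) @ fu_filter omega --> l.
  have [M M0 aM] := linfty_bound a; apply: (@ultralimit _ _ _ (re M)) => n.
  by rewrite modulusP reK ?(ltW M0)// (le_trans (tr_norm (tt n) _)).
have [lim limP] := choice ex.
exists (fun x => lim (urepr x)) => a.
have nul := trace_null tt (urepr_uclass omega a).
have -> : (fun n => t n (a n)) = (fun n => t n ((urepr (uclass a)) n) -
    t n ((urepr (uclass a) - a : linfty A) n)).
  apply/funext => n; rewrite -[- t n _]mulN1r -(trZ (tt n)) -(trD (tt n)).
  by congr (t n _); rewrite scaleN1r /= opprB addrC subrK.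
rewrite -[lim _]subr0; apply: cvgB nul; exact: limP.
Qed.

Lemma uclassM (a b : linfty A) : uclass a ** uclass b = uclass (a ** b).
Proof. exact: umulE. Qed.

Lemma uclass_star (a : linfty A) : star (uclass a) = uclass (star a).
Proof. exact: ustarE. Qed.

Lemma uclassZ c (a : linfty A) : c *: uclass a = uclass (c *: a).
Proof. exact: uscaleE. Qed.

Section induced.
Variables (t : nat -> A -> C) (tau : U -> C).
Hypotheses (tt : forall n, is_trace (t n)) (ttau : induced_by t tau).
Arguments ttau : clear implicits.

Lemma induced_positive_tracial : positive_tracial tau.
Proof.
split.
- move=> c x y; have [a ->] := uclass_surj x; have [b ->] := uclass_surj y.
  rewrite uclassZ -uclassD; apply: cplx_cvg_unique (ttau (c *: a + b)) _ => /=.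
  have -> : (fun n => t n (c *: a n + b n)) = (fun n => c * t n (a n) + t n (b n)).
    by apply/funext => n; rewrite (trD (tt n)) (trZ (tt n)).
  by apply: cvgD (ttau b); apply: cvgM (ttau a); exact: cvg_cst.
- move=> x; have [a ->] := uclass_surj x.
  rewrite uclass_star uclassM.
  have h := ttau (star a ** a).
  suff -> : tau (uclass (star a ** a)) = (modulus (tau (uclass (star a ** a))))%:C%C.
    by rewrite lecR modulus_ge0.
  apply: cplx_cvg_unique h _.
  rewrite [X in X @ _ --> _](_ : _ = fun n => (modulus (t n (star (a n) ** a n)))%:C%C).
    by apply: cvg_real_complex; apply: cvg_modulus; exact: (ttau (star a ** a)).
  by apply/funext => n; rewrite modulusE ger0_norm// (tr_ge0 (tt n)).
- move=> x y; have [a ->] := uclass_surj x; have [b ->] := uclass_surj y.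
  rewrite !uclassM; apply: cplx_cvg_unique (ttau (a ** b)) _ => /=.
  have -> : (fun n => t n (a n ** b n)) = (fun n => t n ((b ** a) n)).
    by apply/funext => n; rewrite (trC (tt n)).
  exact: (ttau (b ** a)).
Qed.

Lemma induced_le (a : linfty A) (M : R) :
  (forall n, modulus (t n (a n)) <= M) -> modulus (tau (uclass a)) <= M.
Proof.
move=> aM.
have h : (fun n => modulus (t n (a n))) @ fu_filter omega -->
    modulus (tau (uclass a)) by apply: cvg_modulus; exact: (ttau a).
rewrite -(cvg_lim _ h)//.
by apply: limr_le; [exact: (cvgP _ h)|exact: nearW].
Qed.

Lemma induced_re_le (a b : linfty A) :
  (forall n, re (t n (a n)) <= re (t n (b n))) ->
  re (tau (uclass a)) <= re (tau (uclass b)).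
Proof.
move=> ab.
have h c : (fun n => re (t n (seq_of c n))) @ fu_filter omega -->
    re (tau (uclass c)) by apply: cvg_re; exact: (ttau c).
have ha := h a; have hb := h b.
rewrite -(cvg_lim _ ha)// -(cvg_lim _ hb)//.
by apply: ler_lim; [exact: (cvgP _ ha)|exact: (cvgP _ hb)|exact: nearW].
Qed.

End induced.

End limit_trace_theory.

(** * The unit of the ultrapower has trace at most 1 *)

Section half_turn.
Variable R : realType.
Local Notation C := (Cplx R).

(** With 2^(m+2) factors 1 + i s, where s = tan(pi / 2^(m+2)), one makes half a
    turn.  The angle is halved algebraically, through
    (1 + i s')^2 = (1 - s'^2) (1 + i s), starting from (1 + i)^4 = -4. *)
Lemma half_turn m : exists2 s : R, 0 <= s <= (2^-1) ^+ m &
  exists2 r : R, 1 <= r & (1 + 'i * s%:C%C : C) ^+ (2 ^ m.+2) = - r%:C%C.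
Proof.
have i2 : ('i : C) * 'i = -1 by rewrite -expr2 sqrCi.
elim: m => [|m [s /andP[s0 sm] [r r1 sr]]].
  exists 1; first by rewrite expr0 lexx ler01.
  exists 4; first by rewrite ler1n.
  rewrite rmorph1 mulr1 (_ : (2 ^ 2)%N = (2 * 2)%N)// exprM.
  have -> : (1 + 'i : C) ^+ 2 = 2 * 'i.
    by rewrite expr2 mulrDl !mulrDr i2; ring.
  by rewrite exprMn expr2 [in X in _ * X]expr2 i2 rmorph_nat; ring.
pose q := Num.sqrt (1 + s ^+ 2); pose s' := s / (1 + q).
have q2 : q ^+ 2 = 1 + s ^+ 2 by rewrite sqr_sqrtr// addr_ge0// sqr_ge0.
have q1 : 1 <= q by rewrite -[leLHS]sqrtr1 ler_wsqrtr// lerDl sqr_ge0.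
have q0 : 0 < 1 + q by lra.
have s'0 : 0 <= s' by rewrite divr_ge0// ltW.
exists s'.
  rewrite s'0/= exprS; apply: le_trans (_ : 2^-1 * s <= _); last by rewrite ler_wpM2l.
  by rewrite /s' mulrC ler_wpM2r// lef_pV2 ?posrE//; lra.
have e1 : 1 - s' ^+ 2 = 2 / (1 + q).
  rewrite /s' expr_div_n (_ : s ^+ 2 = q ^+ 2 - 1); last by rewrite q2; ring.
  by field; rewrite gt_eqF.
have e2 : s' + s' = (1 - s' ^+ 2) * s by rewrite e1 /s'; field; rewrite gt_eqF.
have sq : (1 + 'i * s'%:C%C : C) ^+ 2 = (1 - s' ^+ 2)%:C%C * (1 + 'i * s%:C%C).
  rewrite mulrDr mulr1 (_ : _ * ('i * s%:C%C) = 'i * (s'%:C%C + s'%:C%C)).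
    by rewrite rmorphB rmorph1 rmorphXn /= expr2 mulrDl !mulrDr mulrACA i2; ring.
  by rewrite -rmorphD e2 rmorphM /= mulrCA.
set z := (X in X ^+ 2) in sq.
have zk : z ^+ (2 ^ m.+3) = - (r * (1 - s' ^+ 2) ^+ (2 ^ m.+2))%:C%C.
  by rewrite expnS exprM sq exprMn sr mulrN -rmorphXn -rmorphM /= mulrC.
exists (r * (1 - s' ^+ 2) ^+ (2 ^ m.+2)) => //.
have p0 : 0 <= r * (1 - s' ^+ 2) ^+ (2 ^ m.+2).
  rewrite mulr_ge0 ?exprn_ge0// ?e1 ?divr_ge0 ?(ltW q0)//.
  by rewrite (le_trans _ r1).
have z1 : 1 <= `|z|.
  rewrite -modulusE -(rmorph1 (real_complex R)) lecR.
  apply: le_trans (re_le_modulus _); rewrite /z reD mulrC reMr.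
  by rewrite [re 'i](_ : _ = 0)// mulr0 addr0.
have : 1 <= `|z ^+ (2 ^ m.+3)| by rewrite normrX exprn_ege1.
by rewrite zk normrN -modulusE modulus_real ger0_norm// -(rmorph1 (real_complex R)) lecR.
Qed.

End half_turn.

Section unit_trace.
Context {R : realType} {omega : free_ultrafilter} {A : cstarType R}.
Local Notation C := (Cplx R).
Local Notation U := (ultrapower omega A).
Local Notation uclass := (@uclass R omega A).

Lemma seq_upow (f : linfty A) d k n : upow f d k n = upow (f n) d k.
Proof. by elim: k => [|k IH] //=; rewrite -IH. Qed.

Lemma uclass_upow (f : linfty A) d k : uclass (upow f d k) = upow (uclass f) d k.
Proof.
elim: k => [|k IH] /=.
  by apply: (addIr (uclass 0)); rewrite -uclassD !add0r.
by rewrite -IH !uclassD uclassM !uclassZ.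
Qed.

Lemma star_unit (S : starAlgType R) (e : S) : is_unit_element e -> star e = e.
Proof.
move=> ue; have [es _] := ue (star e).
by have := congr1 star es; rewrite starM starK es => ->.
Qed.

Lemma lift_selfadjoint (x : U) : star x = x ->
  exists2 f : linfty A, star f = f & uclass f = x.
Proof.
have [a ->] := uclass_surj x => sx; pose c : C := 2^-1.
have cc : c^* = c by rewrite /c fmorphV /= rmorph_nat.
exists (c *: (a + star a)); first by rewrite starZ starD starK addrC cc.
rewrite -uclassZ uclassD -uclass_star sx.
by rewrite -mulr2n -scaler_nat scalerA mulVf ?scale1r// pnatr_eq0.
Qed.

(** Let f be a self-adjoint lift of the unit e.  For the d and k of [half_turn],
    (1 + d f)^k - 1 is a lift of ((1 + d)^k - 1) e, where (1 + d)^k - 1 <= -2, and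
    the bound 1 + r^k on its norm tends to 2. *)
Lemma limit_trace_unit_le1 (tau : U -> C) (e : U) :
  limit_traces tau -> is_unit_element e -> re (tau e) <= 1.
Proof.
move=> [t tt ttau] ue; have pt := induced_positive_tracial tt ttau.
have [f fs fe] := lift_selfadjoint (star_unit ue).
have [M' M'0 fM] := linfty_bound f; pose M := re M'.
have MM : M%:C%C = M' by rewrite reK// ltW.
have M0 : 0 <= M by apply/re_ge0/ltW.
have e_ge0 : 0 <= tau e.
  by have := pt_ge0 pt e; rewrite (star_unit ue); have [->] := ue e.
suff key m : 2 * re (tau e) <= 1 + expR (4 * (2^-1) ^+ m * M ^+ 2).
  have lim : 1 + expR (4 * (2^-1) ^+ m * M ^+ 2) @[m --> \oo] --> 1 + expR (4 * 0 * M ^+ 2).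
    apply: cvgD; first exact: cvg_cst.
    apply: continuous_cvg; first exact: continuous_expR.
    apply: cvgM; last exact: cvg_cst.
    apply: cvgM; first exact: cvg_cst.
    by apply: cvg_expr; rewrite ger0_norm ?invr_ge0// invf_lt1// ltr1n.
  have : 2 * re (tau e) <= 1 + expR (4 * 0 * M ^+ 2).
    rewrite -(cvg_lim _ lim)//.
    by apply: limr_ge; [exact: (cvgP _ lim)|exact: nearW].
  by rewrite mulr0 mul0r expR0; lra.
have [s /andP[s0 sm] [r r1 sr]] := half_turn R m.
pose k := (2 ^ m.+2)%N; rewrite -/k in sr.
have [d d_imag dE] : exists2 d : C, d^* = - d & d = 'i * s%:C%C.
  by exists ('i * s%:C%C); rewrite ?imag_conj.
rewrite -dE in sr.
have md : modulus d = s by rewrite dE modulus_imag.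
pose rho : R := Num.sqrt (1 + s ^+ 2 * M ^+ 2).
have rho2 : rho ^+ 2 = 1 + s ^+ 2 * M ^+ 2.
  by rewrite sqr_sqrtr// addr_ge0// mulr_ge0 ?sqr_ge0.
have rho1 : 1 <= rho.
  by rewrite -[leLHS]sqrtr1 ler_wsqrtr// lerDl mulr_ge0 ?sqr_ge0.
have bound : modulus (tau (uclass (upow f d k))) <= 1 + rho ^+ k.
  apply: (induced_le ttau) => n.
  rewrite seq_upow modulusP (le_trans (tr_norm (tt n) _))//.
  rewrite rmorphD rmorph1 rmorphXn /=; apply: upow_norm => //.
  - by rewrite -[in RHS]fs.
  - by rewrite lecR (le_trans _ rho1).
  - rewrite modulus_sq md -[leRHS](rmorphXn (real_complex R)) rho2.
    rewrite (rmorphD (real_complex R)) rmorph1 lerD2l [leRHS](rmorphM (real_complex R)).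
    rewrite ler_wpM2l ?lecR ?sqr_ge0// (rmorphXn (real_complex R)) /= MM.
    by rewrite lerXn2r ?nnegrE// ltW.
have eid : e ** e = e by have [] := ue e.
rewrite uclass_upow fe (upow_unit _ _ eid) (ptZ pt) sr in bound.
move: bound; rewrite modulusM -opprD modulusN.
rewrite -(rmorph1 (real_complex R)) -rmorphD modulus_real.
rewrite ger0_norm; last by lra.
rewrite -re_ge0_modulus// => bound.
apply: (@le_trans _ _ ((r + 1) * re (tau e))).
  by apply: ler_wpM2r; [exact: re_ge0|lra].
apply: (le_trans bound); rewrite lerD2l.
apply: (@le_trans _ _ (rho ^+ (2 * k))).
  by apply: ler_weXn2l => //; rewrite leq_pmull.
rewrite exprM rho2; apply: (@le_trans _ _ (expR (s ^+ 2 * M ^+ 2) ^+ k)).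
  rewrite lerXn2r ?nnegrE ?expR_ge0 ?expR_ge1Dx//.
  by rewrite addr_ge0// mulr_ge0 ?sqr_ge0.
rewrite -expRM_natl ler_expR mulrA ler_wpM2r ?sqr_ge0//.
apply: (@le_trans _ _ (k%:R * ((2^-1) ^+ m) ^+ 2)).
  by rewrite ler_wpM2l// lerXn2r ?nnegrE// exprn_ge0// invr_ge0.
rewrite /k expnS expnS mulnA natrM natrX -mulrA ler_wpM2l//.
by rewrite expr2 mulrA -exprMn mulfV ?pnatr_eq0// expr1n mul1r.
Qed.

End unit_trace.

(** * The maximum principle for traces *)

Section ultracompactness.
Context {R : realType} (omega : free_ultrafilter) {A : cstarType R}.
Local Notation C := (Cplx R).

(** The only consequence of compactness in the weak* topology that is used: a
    sequence in X has a pointwise limit in X along the ultrafilter. *)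
Definition ultracompact (X : set (A -> C)) :=
  forall f : nat -> A -> C, (forall n, X (f n)) ->
  exists2 g, X g & forall a, (fun n => f n a) @ fu_filter omega --> g a.

Lemma compact_ultracompact (X : set {ptws A -> C}) :
  compact X -> ultracompact X.
Proof.
move=> cX f Xf; move: cX; rewrite compact_ultra.
move=> /(_ ((f : nat -> {ptws A -> C}) @ fu_filter omega) _)[||g [Xg fg]].
- exact: ultra_fmap.
- by apply: (@filterS _ (fu_filter omega) _ setT) => [n _ /=|]; last exact: filterT.
exists g => // a; move/pointwise_cvgP: fg => /(_ a); exact.
Qed.

Section faces.
Variable X : set (A -> C).
Hypotheses (Xb : forall f a, X f -> modulus (f a) <= re `|a|)
  (Xc : ultracompact X).

Definition face (Y : set (A -> C)) (w : A) : set (A -> C) :=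
  [set f | Y f /\ forall g, Y g -> re (g w) <= re (f w)].

Lemma face_nonempty Y w : Y `<=` X -> ultracompact Y -> Y !=set0 ->
  face Y w !=set0.
Proof.
move=> YX Yc [f0 Yf0]; pose S := [set re (f w) | f in Y].
have supS : has_sup S.
  split; first by exists (re (f0 w)); exists f0.
  exists (re `|w|) => _ [f Yf <-].
  by rewrite (le_trans (re_le_modulus _))// Xb//; exact: YX.
have ex n : exists f, Y f /\ sup S - n.+1%:R^-1 < re (f w).
  have [_ [f Yf <-] h] : exists2 x, S x & sup S - n.+1%:R^-1 < x.
    by apply: sup_adherent => //; rewrite invr_gt0.
  by exists f.
have [f fP] := choice ex.
have [g Yg fg] := Yc f (fun n => (fP n).1).
exists g; split=> // h Yh; apply: (@le_trans _ _ (sup S)).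
  by apply: sup_upper_bound => //; exists h.
have lim1 : (fun n => re (f n w)) @ fu_filter omega --> re (g w).
  by apply: cvg_re; exact: fg.
have lim2 : (fun n => sup S - n.+1%:R^-1) @ fu_filter omega --> sup S.
  apply: cvg_omega; rewrite -[X in _ --> X]subr0.
  apply: cvgB; first exact: cvg_cst.
  exact: cvg_harmonic.
rewrite -(cvg_lim _ lim1)// -(cvg_lim _ lim2)//.
apply: ler_lim; [exact: (cvgP _ lim2)|exact: (cvgP _ lim1)|].
by apply: nearW => n; apply/ltW; exact: (fP n).2.
Qed.

Lemma face_ultracompact Y w : ultracompact Y -> ultracompact (face Y w).
Proof.
move=> Yc f Ff; have [g Yg fg] := Yc f (fun n => (Ff n).1).
exists g => //; split=> // h Yh.
have lim : (fun n => re (f n w)) @ fu_filter omega --> re (g w).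
  by apply: cvg_re; exact: fg.
rewrite -(cvg_lim _ lim)//; apply: limr_ge; first exact: (cvgP _ lim).
by apply: nearW => n; exact: (Ff n).2.
Qed.

Variable w : nat -> A.

Fixpoint faces k := if k is k'.+1 then face (faces k') (w k') else X.

Lemma faces_decr i j : (i <= j)%N -> faces j `<=` faces i.
Proof.
elim: j => [|j IH]; first by rewrite leqn0 => /eqP ->.
by rewrite leq_eqVlt => /predU1P[->//|/IH ji] f [/ji].
Qed.

Lemma faces_ultracompact k : ultracompact (faces k).
Proof. by elim: k => //= k; exact: face_ultracompact. Qed.

Lemma faces_nonempty k : X !=set0 -> faces k !=set0.
Proof.
move=> X0; elim: k => //= k IH; apply: face_nonempty => //.
  exact: (@faces_decr 0).
exact: faces_ultracompact.
Qed.

(** Choosing a point in each member of a decreasing sequence of ultracompact sets,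
    the limit along the ultrafilter lies in all of them, as freeness allows to
    drop the first terms. *)
Lemma faces_inter : X !=set0 -> exists s, forall k, faces k s.
Proof.
move=> X0; have [f fP] := choice (fun k => faces_nonempty k X0).
have ff i j : (i <= j)%N -> faces i (f j) by move=> ij; exact: faces_decr (fP j).
have [s Xs fs] := Xc (fun n => ff 0%N n (leq0n n)).
exists s => k.
have [g Yg gs] := faces_ultracompact (fun n => ff k (maxn k n) (leq_maxl k n)).
suff -> : s = g by [].
apply/funext => a; apply: cplx_cvg_unique (fs a) _.
have h := gs a; apply: cvg_trans h; apply: near_eq_cvg.
apply: cofinite_omega; exists k => // n /= kn.
by rewrite (maxn_idPr kn).
Qed.

(** A functional which maximizes lexicographically a separating sequence of real
    linear functionals is an extreme point. *)
Lemma faces_extreme s : (forall k, faces k s) ->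
  (forall f g, X f -> X g -> (forall k, re (f (w k)) = re (g (w k))) -> f = g) ->
  extreme_points X s.
Proof.
move=> Fs sep; split=> [|g h t Xg Xh /andP[t0 t1] sgh]; first exact: (Fs 0%N).
pose r := re t; have tr : r%:C%C = t by rewrite reK// ltW.
have r0 : 0 < r by rewrite -ltcR tr.
have r1 : r < 1 by rewrite -ltcR tr.
have sw a : re (s a) = r * re (g a) + (1 - r) * re (h a).
  rewrite sgh -tr reD reMr; congr (_ + _).
  by rewrite -(rmorph1 (real_complex R)) -rmorphB reMr.
suff key k : [/\ faces k g, faces k h &
    forall j, (j < k)%N -> re (g (w j)) = re (s (w j)) /\ re (h (w j)) = re (s (w j))].
  have Xs := Fs 0%N.
  by split; apply: sep => // k; have [_ _ /(_ k (ltnSn k))[]] := key k.+1.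
elim: k => [|k [Fg Fh eqs]]; first by split.
have [Fsk maxs] := Fs k.+1.
have gs := maxs g Fg; have hs := maxs h Fh; have e := sw (w k).
(* s(w_k) is a proper convex combination of numbers which do not exceed it. *)
have ge : re (g (w k)) = re (s (w k)) by nra.
have he : re (h (w k)) = re (s (w k)) by nra.
split.
- by split=> // f /maxs; rewrite ge.
- by split=> // f /maxs; rewrite he.
- by move=> j; rewrite ltnS leq_eqVlt => /predU1P[->//|]; exact: eqs.
Qed.

End faces.

End ultracompactness.

Section maximum_principle.
Context {R : realType} (omega : free_ultrafilter) {A : cstarType R}.
Local Notation C := (Cplx R).

Lemma dense_sequence : separable_space A ->
  exists d : nat -> A, forall (a : A) (e : R), 0 < e -> exists k, re `|a - d k| < e.
Proof.
move=> [D /countable_injP[f finj] dD].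
have ex k : exists x, forall y, D y -> f y = k -> x = y.
  have [[y [Dy yk]]|no] := pselect (exists y, D y /\ f y = k).
    by exists y => z Dz zk; apply: finj; rewrite ?inE// yk zk.
  by exists 0 => y Dy yk; case: no; exists y.
have [d dP] := choice ex; exists d => a e e0.
have e0' : 0 < (e%:C%C : C) by rewrite ltcR.
have aO : (interior (ball a (e%:C%C : C))) a by exact: nbhsx_ballx.
have [y [yO Dy]] := dD _ (ex_intro _ _ aO) (@open_interior _ _).
exists (f y); rewrite (dP _ y Dy erefl).
have := interior_subset yO; rewrite -ball_normE /= => ay.
by rewrite -ltcR reK.
Qed.

Lemma traces_bound (f : A -> C) a : traces A f -> modulus (f a) <= re `|a|.
Proof. by move=> tf; apply/re_le/tr_norm. Qed.

Lemma traces_determined (d : nat -> A) (f g : A -> C) :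
  (forall (a : A) (e : R), 0 < e -> exists k, re `|a - d k| < e) ->
  traces A f -> traces A g -> (forall k, f (d k) = g (d k)) -> f = g.
Proof.
move=> dd tf tg fg; apply/funext => a; apply/eqP; rewrite -subr_eq0; apply/eqP.
apply: modulus_eq0; apply/eqP; rewrite eq_le modulus_ge0 andbT.
apply/ler_addgt0Pr => e e0; rewrite add0r.
have [k ak] := dd a (e / 2) (divr_gt0 e0 (ltr0n R 2)).
have subE h : traces A h -> h a = h (d k) + h (a - d k).
  by move=> th; rewrite -(trD th) addrC subrK.
rewrite (subE f tf) (subE g tg) fg [X in X - _]addrC addrKA.
rewrite (le_trans (modulusD _ _))// modulusN.
have := traces_bound (a - d k) tf; have := traces_bound (a - d k) tg.
by lra.
Qed.

(** The part of the Krein-Milman theorem that is needed: a continuous linear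
    functional attains its maximum on T(A) at an extreme point. *)
Lemma extreme_trace_max (A_sep : separable_space A)
    (T_compact : compact (traces A)) (f : A -> C) (a : A) :
  traces A f -> exists2 s, extreme_points (traces A) s & modulus (f a) <= modulus (s a).
Proof.
move=> tf; have [d dd] := dense_sequence A_sep.
have [c c1 cfa] := rotate_to_modulus (f a).
(* The real functionals re f(d_k) and re f(- i d_k) = im f(d_k) are separating. *)
pose w k := if k is k'.+1 then
  (if odd k' then d k'./2 else - 'i *: d k'./2) else c *: a.
have Tc := compact_ultracompact omega T_compact.
have [s Fs] := faces_inter traces_bound Tc w (ex_intro _ _ tf).
have ts : traces A s := Fs 0%N.
exists s.
  apply: faces_extreme Fs _ => g h tg th eqw; apply: (traces_determined dd tg th) => k.
  have := eqw (k.*2.+2); have := eqw (k.*2.+1).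
  rewrite /w /= odd_double /= uphalf_double doubleK (trZ tg) (trZ th) !re_mulNi.
  by case: (g _) (h _) => [x y] [x' y']; rewrite /re /= => -> ->.
have [_ /(_ _ tf)] := Fs 1%N; rewrite /w /= (trZ tf) (trZ ts) cfa => h.
apply: (le_trans h); apply: (le_trans (re_le_modulus _)).
by rewrite modulusM [modulus c]/modulus c1 mul1r.
Qed.

End maximum_principle.

(** * Limit traces restricted to the algebra, and their cuts by projections *)

Section limit_traces_on_the_algebra.
Context {R : realType} {omega : free_ultrafilter} {A : cstarType R}.
Local Notation C := (Cplx R).
Local Notation U := (ultrapower omega A).
Local Notation uclass := (@uclass R omega A).
Local Notation iota := (@iota_ultrapower R omega A).

Lemma iotaM a b : iota a ** iota b = iota (a ** b).
Proof. by rewrite /iota_ultrapower uclassM; congr uclass; exact: linfty_eq. Qed.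

Lemma iota_star a : star (iota a) = iota (star a).
Proof. by rewrite /iota_ultrapower uclass_star; congr uclass; exact: linfty_eq. Qed.

Lemma iotaD a b : iota (a + b) = iota a + iota b.
Proof. by rewrite /iota_ultrapower -uclassD; congr uclass; exact: linfty_eq. Qed.

Lemma iotaZ c a : iota (c *: a) = c *: iota a.
Proof. by rewrite /iota_ultrapower uclassZ; congr uclass; exact: linfty_eq. Qed.

(** A limit trace restricts to the pointwise limit of the traces which define it,
    so that it inherits membership in a compact set. *)
Lemma restrict_limit_trace (X : set {ptws A -> C}) (t : nat -> A -> C) (tau : U -> C) :
  compact X -> (forall n, X (t n)) -> induced_by t tau ->
  X (fun a => tau (iota a)).
Proof.
move=> cX Xt ttau; have [g Xg tg] := compact_ultracompact omega cX Xt.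
suff -> : (fun a => tau (iota a)) = g by [].
by apply/funext => a; apply: cplx_cvg_unique (ttau (linfty_cst a)) (tg a).
Qed.

Section fixed_limit_trace.
Variables (tau : U -> C) (e : U).
Hypotheses (ltau : limit_traces tau) (ue : is_unit_element e)
  (T_compact : compact (traces A)).

Lemma limit_trace_positive_tracial : positive_tracial tau.
Proof. by have [t tt ttau] := ltau; exact: (induced_positive_tracial tt ttau). Qed.

Lemma restrict_is_trace : is_trace (fun a => tau (iota a)).
Proof.
have [t tt ttau] := ltau.
exact: (@restrict_limit_trace (traces A) t tau T_compact tt ttau).
Qed.

Let pt := limit_trace_positive_tracial.
Let ts := restrict_is_trace.

Lemma trace_almost_one (d : R) : 0 < d -> exists2 a : A, `|a| <= 1 &
  exists2 m : R, tau (iota a) = m%:C%C & 1 - d < m <= 1.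
Proof.
move=> d0; have [[_ _ n1] _] := ts.
have : ((1 - d)%:E < functional_norm (fun a => tau (iota a)))%E.
  by rewrite n1 lte_fin; lra.
move=> /ereal_sup_gt[_ [b /= b1 <-]]; rewrite lte_fin -/(modulus _) => db.
have [c c1 ctau] := rotate_to_modulus (tau (iota b)).
exists (c *: b); first by rewrite normrZ c1 mul1r.
exists (modulus (tau (iota b))); first by rewrite iotaZ (ptZ pt).
rewrite db/= modulusP rmorph1.
exact: (le_trans (tr_norm ts b) b1).
Qed.

(** The restriction of [tau] to A has norm 1, so that some contraction a of A
    has tau(a) close to 1; this a is close to the unit in the 2-norm. *)
Lemma approximate_unit (d : R) : 0 < d -> exists2 a : A, `|a| <= 1 &
  modulus (tau (iota a) - 1) <= d /\
  forall x, modulus (tau x - tau (iota a ** x)) <= d * seminorm2 tau x.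
Proof.
move=> d0; pose d' := Num.min d (d ^+ 2 / 2).
have d'0 : 0 < d' by rewrite lt_min d0 divr_gt0 ?exprn_gt0.
have [a a1 [m taum /andP[m1 m2]]] := trace_almost_one d'0; exists a => //.
have d'd : d' <= d by rewrite ge_min lexx.
have d'd2 : d' <= d ^+ 2 / 2 by rewrite ge_min lexx orbT.
split.
  rewrite taum -(rmorph1 (real_complex R)) -rmorphB modulus_real.
  by rewrite ler_norml; apply/andP; split; lra.
move=> x; have [ex _] := ue x.
have -> : tau x - tau (iota a ** x) = tau (star (star (e - iota a)) ** x).
  by rewrite starK -[- iota a]scaleN1r amulDl amulZl ex scaleN1r (ptB pt).
rewrite (le_trans (cauchy_schwarz pt _ _))// ler_wpM2r ?seminorm2_ge0//.
apply: seminorm2_leP; first exact: ltW.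
rewrite starK (ptC pt) -scaleN1r (pt_expand pt).
rewrite (pt_hermitian pt e (iota a)) (star_unit ue).
have [-> _] := ue e; have [-> _] := ue (iota a).
rewrite taum (_ : (m%:C%C : C)^* = m%:C%C); last first.
  by apply/CrealP; rewrite complex_real.
rewrite rmorphN1 normrN1 expr1n mul1r mulN1r.
rewrite iota_star iotaM !reD reN.
have e1 := limit_trace_unit_le1 ltau ue.
have : re (tau (iota (star a ** a))) <= 1.
  have := re_le (tr_sq_norm ts a); move/le_trans; apply.
  by have := @re_le R (`|a| ^+ 2) 1; apply; rewrite expr_le1.
by rewrite /(re m%:C%C) /=; lra.
Qed.

(** Letting an approximate unit of A tend to e in tau(a p) = c tau(a). *)
Lemma trace_of_projection (p : U) (c : C) :
  (forall a, tau (iota a ** p) = c * tau (iota a)) -> tau p = c.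
Proof.
move=> h; apply: (@eq_of_modulus_small _ _ _ (seminorm2 tau p + modulus c)) => d d0.
have [a _ [a1 ax]] := approximate_unit d0.
have -> : tau p - c = (tau p - tau (iota a ** p)) + c * (tau (iota a) - 1).
  by rewrite h; ring.
rewrite (le_trans (modulusD _ _))// [leRHS]mulrDr lerD ?ax// modulusM mulrC.
by rewrite ler_wpM2r ?modulus_ge0.
Qed.

(** Cutting down by a projection which commutes with A yields a trace on A.  Its
    norm is tau(p), by Cauchy-Schwarz and by testing on approximate units. *)
Lemma cut_trace (p : U) (c : R) : is_projection p ->
  commutant (range iota) p -> 0 < c -> tau p = c%:C%C ->
  is_trace (fun a => c^-1%:C%C * tau (iota a ** p)).
Proof.
move=> [ps pp] pA c0 taup.
have cV : 0 < c^-1 by rewrite invr_gt0.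
have comm a : iota a ** p = p ** iota a by rewrite pA//; exists a.
have cut a : tau (iota a ** p) = tau (star p ** (iota a ** p)).
  by rewrite ps (ptC pt p) -amulA pp.
have sp : seminorm2 tau p ^+ 2 = c by rewrite (seminorm2_sq pt) ps pp taup.
have bound a : `|a| <= 1 -> modulus (tau (iota a ** p)) <= c.
  move=> a1; rewrite cut (le_trans (cauchy_schwarz pt _ _))//.
  rewrite -sp expr2 ler_wpM2l ?seminorm2_ge0//.
  apply: seminorm2_leP; first exact: seminorm2_ge0.
  rewrite (seminorm2_sq pt); have [P ->] := uclass_surj p.
  have [t tt ttau] := ltau.
  rewrite /iota_ultrapower (uclassM (linfty_cst a) P) !uclass_star !uclassM.
  apply: (induced_re_le ttau) => n /=; apply: re_le.
  exact: (tr_sqM_unit (tt n)).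
split; last first.
  move=> a b; congr (_ * _); rewrite -!iotaM -[in LHS]amulA comm [in LHS]amulA.
  by rewrite (ptC pt) amulA.
split.
- move=> k a b; rewrite iotaD iotaZ amulDl amulZl (ptD pt) (ptZ pt) mulrDr.
  by rewrite mulrCA.
- move=> a; rewrite mulr_ge0 ?lecR ?(ltW cV)// cut -iotaM -iota_star.
  by rewrite -amulA amulA -starM (pt_ge0 pt).
- apply/eqP; rewrite eq_le; apply/andP; split.
    apply: ge_ereal_sup => _ [a /= a1 <-]; rewrite lee_fin.
    rewrite [leLHS](modulusM c^-1%:C%C) modulus_real gtr0_norm//.
    by rewrite ler_pdivrMl// mulr1 bound.
  apply/lee_addgt0Pr => d d0.
  pose K := c^-1 * seminorm2 tau p.
  have K0 : 0 <= K by rewrite mulr_ge0 ?seminorm2_ge0// ltW.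
  have K1 : 0 < K + 1 by rewrite ltr_wpDl.
  have [a a1 [_ /(_ p) ap]] := approximate_unit (divr_gt0 d0 K1).
  pose f a := c^-1%:C%C * tau (iota a ** p).
  apply: (@le_trans _ _ ((modulus (f a))%:E + d%:E)%E); last first.
    by apply: leeD2r; apply: ereal_sup_ubound; exists a.
  rewrite -EFinD lee_fin /f modulusM modulus_real gtr0_norm//.
  have := modulusB (tau p) (tau p - tau (iota a ** p)).
  rewrite opprB addrCA subrr addr0 {1}taup modulus_real gtr0_norm// => h.
  have {}h : c - d / (K + 1) * seminorm2 tau p <= modulus (tau (iota a ** p)) by lra.
  rewrite -lerBlDr; apply: (@le_trans _ _ (c^-1 * (c - d / (K + 1) * seminorm2 tau p))).
    rewrite mulrBr mulVf ?gt_eqF// lerD2l lerN2 mulrCA -/K -mulrA ler_piMr ?(ltW d0)//.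
    by rewrite mulrC ler_pdivrMr// mul1r lerDl.
  by rewrite ler_wpM2l// ltW.
Qed.

End fixed_limit_trace.

End limit_traces_on_the_algebra.

(** * Limits of extreme traces, and the equivalence *)

Section extreme_limit_traces.
Context {R : realType} {omega : free_ultrafilter} {A : cstarType R}.
Local Notation C := (Cplx R).
Local Notation U := (ultrapower omega A).
Local Notation uclass := (@uclass R omega A).
Local Notation iota := (@iota_ultrapower R omega A).

(** If [tau] restricts to an extreme trace, then the restriction is the convex
    combination of its cuts by p and by e - p, hence equal to both. *)
Lemma extreme_cut (t : nat -> A -> C) (tau : U -> C) (e p : U) (c : R) :
  compact (traces A) -> compact (extreme_points (traces A)) ->
  (forall n, extreme_points (traces A) (t n)) -> induced_by t tau ->
  is_unit_element e -> is_projection p -> commutant (range iota) p ->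
  tau e = 1 -> tau p = c%:C%C -> 0 < c < 1 ->
  forall a, tau (iota a ** p) = c%:C%C * tau (iota a).
Proof.
move=> cT cE Et ttau ue [ps pp] pA te tp /andP[c0 c1] a.
have ltau : limit_traces tau by exists t => // n; exact: (Et n).1.
have pt := limit_trace_positive_tracial ltau.
have [_ ext] := restrict_limit_trace cE Et ttau.
have [ep pe] := ue p; have [ee _] := ue e.
pose q := e - p.
have qE x : q ** x = e ** x - p ** x by rewrite amulDl -[- p]scaleN1r amulZl scaleN1r.
have Eq x : x ** q = x ** e - x ** p.
  by rewrite amulDr -[- p]scaleN1r amulZr scaleN1r.
have qproj : is_projection q.
  split; last by rewrite qE !Eq ee ep pe pp subrr subr0.
  by rewrite /q -[- p]scaleN1r starD starZ (star_unit ue) ps rmorphN1.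
have qA : commutant (range iota) q.
  move=> x Ax; rewrite qE Eq (pA x Ax).
  by have [-> ->] := ue x.
have c1' : 0 < 1 - c by lra.
have tq : tau q = (1 - c)%:C%C by rewrite /q (ptB pt) te tp rmorphB rmorph1.
have g_trace := cut_trace ltau ue cT (conj ps pp) pA c0 tp.
have h_trace := cut_trace ltau ue cT qproj qA c1' tq.
have cancelV (r : R) z : 0 < r -> (r%:C%C : C) * (r^-1%:C%C * z) = z.
  by move=> r0; rewrite mulrA -rmorphM /= mulfV ?gt_eqF// rmorph1 mul1r.
have c01 : 0 < (c%:C%C : C) < 1.
  by rewrite ltcR c0/= -(rmorph1 (real_complex R)) ltcR.
have convex : (fun x => tau (iota x)) = fun x =>
    c%:C%C * (c^-1%:C%C * tau (iota x ** p)) +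
    (1 - c%:C%C) * ((1 - c)^-1%:C%C * tau (iota x ** q)).
  apply/funext => x; rewrite cancelV//.
  rewrite (_ : 1 - c%:C%C = (1 - c)%:C%C) ?cancelV//; last by rewrite rmorphB rmorph1.
  by rewrite Eq (ptB pt) addrC subrK; have [_ ->] := ue (iota x).
have [gE _] := ext _ _ _ g_trace h_trace c01 convex.
by rewrite -(congr1 (fun f => f a) gE) cancelV.
Qed.

End extreme_limit_traces.

Theorem corollary3p2 (R : realType) (omega : free_ultrafilter)
    (A : cstarType R) (A_separable : separable_space A)
    (A_bauer : bauer_traces A) :
  uniform_property_Gamma omega A <->
  (forall n : nat, (0 < n)%N ->
     exists p : 'I_n -> ultrapower omega A,
       central_partition p /\
       forall (tau : ultrapower omega A -> Cplx R) (i : 'I_n),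
         limit_traces tau -> tau (p i) = n%:R^-1).
Proof.
have [cT _ cE] := A_bauer; split=> Gamma n n0; have [p [[pp pA p1] ptau]] := Gamma n n0.
  exists p; split=> // tau i ltau.
  by apply: (trace_of_projection ltau p1 cT) => a; exact: ptau.
exists p; split=> // a tau i ltau.
pose iota := @iota_ultrapower R omega A.
have natC : (n%:R^-1 : Cplx R) = (n%:R^-1)%:C%C.
  by rewrite fmorphV rmorph_nat.
have extreme_case (t : nat -> A -> Cplx R) (s : ultrapower omega A -> Cplx R) :
    (forall k, extreme_points (traces A) (t k)) -> induced_by t s ->
    s (iota a ** p i) = n%:R^-1 * s (iota a).
  move=> Et ts; have ls : limit_traces s by exists t => // k; exact: (Et k).1.
  have pts := limit_trace_positive_tracial ls.
  have s1 : s (\sum_(j < n) p j) = 1.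
    rewrite (big_morph s (ptD pts) (pt0 pts)).
    rewrite (eq_bigr (fun=> n%:R^-1)) => [|j _]; last exact: ptau.
    by rewrite sumr_const card_ord -[LHS]mulr_natl mulfV// pnatr_eq0 -lt0n.
  have [n1|n1] := leqP n 1.
    (* For n = 1 the projection is the unit, and has no complement to cut by. *)
    have {n1} n1 : n = 1%N by apply/eqP; rewrite eqn_leq n1 n0.
    subst n; rewrite big_ord1 in p1; rewrite (ord1 i).
    by have [_ ->] := p1 (iota a); rewrite invr1 mul1r.
  rewrite natC; apply: (extreme_cut cT cE Et ts p1 (pp i) (pA i) s1).
    by rewrite -natC ptau.
  by rewrite invr_gt0 ltr0n n0/= invf_lt1 ?ltr0n// ltr1n.
have pt := limit_trace_positive_tracial ltau.
have [t tt ttau] := ltau.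
(* The defect tau(a p_i) - tau(a)/n is the value of tau on the class of w.  For each
   k some extreme trace is at least as large on w_k as t_k, and for a sequence of
   extreme traces the limit is 0. *)
have [P PE] := uclass_surj (p i).
pose w : linfty A := linfty_cst a ** P - n%:R^-1 *: linfty_cst a.
have wE s : limit_traces s ->
    s (uclass omega w) = s (iota a ** p i) - n%:R^-1 * s (iota a).
  move=> ls; have pts := limit_trace_positive_tracial ls.
  rewrite -(ptZ pts) -(ptB pts) PE /iota /iota_ultrapower uclassM uclassZ.
  by rewrite -scaleN1r uclassZ scaleN1r -uclassD.
apply/eqP; rewrite -subr_eq0 -wE//; apply/eqP.
have max k : exists f : A -> Cplx R,
    extreme_points (traces A) f /\ modulus (t k (w k)) <= modulus (f (w k)).
  have [f Ef wf] := extreme_trace_max omega A_separable cT (w k) (tt k).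
  by exists f.
have [s sP] := choice max.
have Es k : extreme_points (traces A) (s k) by have [] := sP k.
have [sigma ssigma] := @limit_trace_exists R omega A s (fun k => (Es k).1).
have sigma0 : sigma (uclass omega w) = 0.
  rewrite wE; last by exists s => // k; exact: (Es k).1.
  by rewrite (extreme_case s sigma Es ssigma) subrr.
apply: cplx_cvg_unique (ttau w) _; apply/modulus_cvgP.
apply: (@squeeze_cvgr _ _ _ _ (fun=> 0) (fun k => modulus (0 - s k (w k)))).
- apply: nearW => k; rewrite modulus_ge0/= !sub0r !modulusN.
  by have [] := sP k.
- exact: cvg_cst.
- by apply/modulus_cvgP; rewrite -[X in _ --> X]sigma0; exact: (ssigma w).
Qed.
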